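(* Let $G$ be an undirected graph with $n$ vertices and $m$ edges undergoing vertex updates. An algorithm for maintaining a DFS tree under vertex updates that can report the number of children of the root in the DFS tree, with preprocessing time $p(m,n)$, update time $u(m,n)$ and query time $q(m,n)$, would imply an algorithm for subgraph connectedness with preprocessing time $p(m+n,n)$, update time $u(m+n,n)$ and query time $q(m+n,n)$.
   Context: A DFS tree of an undirected graph rooted at $r$ is a rooted spanning tree in which every non-tree edge joins a vertex to one of its ancestors in the tree. Vertex updates are insertions and deletions of vertices (a vertex insertion includes its incident edges). In the subgraph connectedness problem, each vertex of $G$ can be switched between active and inactive by an update, and a query asks whether the subgraph of $G$ induced by the active vertices is connected. *)

(* Defs.v *)
From mathcomp Require Import all_boot.

Set Implicit Arguments.
Unset Strict Implicit.
Unset Printing Implicit Defensive.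

(** * Word RAM

    Programs of a RAM with words of [w] bits, finitely many word registers and
    finitely many word-addressed arrays (a program mentions finitely many
    register and array names).  Every elementary instruction and every test
    takes one unit of time. *)

Inductive binop :=
  OAdd | OSub | OMul | ODiv | OMod | OLt | OEq | OAnd | OOr | OXor | OShl | OShr.

Definition eval_binop (o : binop) (x y : nat) : nat :=
  match o with
  | OAdd => x + y
  | OSub => x - y
  | OMul => x * y
  | ODiv => x %/ y
  | OMod => x %% y
  | OLt => x < y
  | OEq => x == y
  | OAnd => Nat.land x y
  | OOr => Nat.lor x y
  | OXor => Nat.lxor x y
  | OShl => Nat.shiftl x y
  | OShr => Nat.shiftr x y
  end.

Inductive cmd :=
  | Skip
  | Const (x c : nat)                (* x := c *)
  | Binop (o : binop) (x y z : nat)  (* x := y o z *)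
  | Get (x a y : nat)                (* x := a[y] *)
  | Put (a x y : nat)                (* a[x] := y *)
  | Seq (c1 c2 : cmd)
  | If (x : nat) (c1 c2 : cmd)       (* test: x <> 0 *)
  | While (x : nat) (c : cmd).       (* test: x <> 0 *)

Record state := State { reg : nat -> nat; arr : nat -> nat -> nat }.

Definition set_reg (s : state) (x v : nat) : state :=
  State (fun y => if y == x then v else reg s y) (arr s).

Definition set_arr (s : state) (a i v : nat) : state :=
  State (reg s)
    (fun b j => if (b == a) && (j == i) then v else arr s b j).

Definition zero_state : state := State (fun _ => 0) (fun _ _ => 0).

(* [exec w c s t s']: on words of [w] bits, [c] started in [s] halts in [s']
   after [t] time units. *)
Inductive exec (w : nat) : cmd -> state -> nat -> state -> Prop :=
  | ExecSkip s : exec w Skip s 1 s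
  | ExecConst x c s : exec w (Const x c) s 1 (set_reg s x (c %% 2 ^ w))
  | ExecBinop o x y z s :
      exec w (Binop o x y z) s 1
        (set_reg s x (eval_binop o (reg s y) (reg s z) %% 2 ^ w))
  | ExecGet x a y s :
      exec w (Get x a y) s 1 (set_reg s x (arr s a (reg s y)))
  | ExecPut a x y s :
      exec w (Put a x y) s 1 (set_arr s a (reg s x) (reg s y))
  | ExecSeq c1 c2 s1 t1 s2 t2 s3 :
      exec w c1 s1 t1 s2 -> exec w c2 s2 t2 s3 ->
      exec w (Seq c1 c2) s1 (t1 + t2) s3
  | ExecIf x c1 c2 s t s' :
      exec w (if reg s x != 0 then c1 else c2) s t s' ->
      exec w (If x c1 c2) s t.+1 s'
  | ExecWhileEnd x c s :
      reg s x = 0 -> exec w (While x c) s 1 s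
  | ExecWhileLoop x c s t1 s1 t2 s2 :
      reg s x <> 0 -> exec w c s t1 s1 -> exec w (While x c) s1 t2 s2 ->
      exec w (While x c) s (t1 + t2).+1 s2.

(* An input is written into the first cells of array 0, and its length into
   register 0; everything else is left as it was. *)
Definition feed (xs : seq nat) (s : state) : state :=
  State (fun x => if x == 0 then size xs else reg s x)
    (fun a i => if (a == 0) && (i < size xs) then nth 0 xs i else arr s a i).

(* The operation [c], called on input [xs] in memory [s], terminates within
   time [b] in a memory satisfying [Q].  Receiving a word of the input takes
   one unit of time.  (Execution is deterministic, so the existential speaks
   about the run.)  *)
Definition call (w : nat) (c : cmd) (xs : seq nat) (s : state) (b : nat)
    (Q : state -> Prop) : Prop :=
  exists t s', [/\ exec w c (feed xs s) t s', size xs + t <= b & Q s'].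

(* The memory persists between operations; a query leaves its answer in
   register 0. *)
Record dyn_algorithm := DynAlgorithm {
  preprocess : cmd;
  update : cmd;
  query : cmd
}.

(** * Graphs *)

Record graph (n : nat) := Graph {
  verts : {set 'I_n};
  edges : {set {set 'I_n}}
}.

Section Graphs.

Variable n : nat.
Implicit Types (G : graph n) (r v : 'I_n).

Definition wf_graph G : Prop :=
  forall e, e \in edges G -> #|e| = 2 /\ e \subset verts G.

Definition adj G : rel 'I_n := fun x y => [set x; y] \in edges G.

(* The empty graph counts as connected. *)
Definition connected G : bool :=
  [forall x in verts G, forall y in verts G, connect (adj G) x y].

Definition induced G (S : {set 'I_n}) : graph n :=
  Graph (verts G :&: S) [set e in edges G | e \subset S].

(* A rooted tree is given by its parent map [T], with [T r = r] at the root, so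
   that [fconnect T v a] says that [a] is an ancestor of [v]. *)
Definition spanning_tree G r (T : 'I_n -> 'I_n) : Prop :=
  [/\ T r = r,
      forall v, v \in verts G -> v != r -> adj G v (T v) &
      forall v, v \in verts G -> fconnect T v r].

Definition dfs_tree G r (T : 'I_n -> 'I_n) : Prop :=
  [/\ r \in verts G, spanning_tree G r T &
      forall x y, adj G x y -> T x != y -> T y != x ->
        fconnect T x y \/ fconnect T y x].

Definition root_children G r (T : 'I_n -> 'I_n) : nat :=
  #|[set v in verts G | (v != r) && (T v == r)]|.

Inductive vertex_update :=
  | Insert of 'I_n & seq 'I_n  (* a vertex and its neighbours *)
  | Delete of 'I_n.

Definition apply_update G (o : vertex_update) : graph n :=
  match o with
  | Insert v N =>
      Graph (v |: verts G) (edges G :|: [set [set v; x] | x in N])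
  | Delete v => Graph (verts G :\ v) [set e in edges G | v \notin e]
  end.

Definition update_ok G r (o : vertex_update) : Prop :=
  match o with
  | Insert v N => [/\ v \notin verts G, uniq N & {subset N <= verts G}]
  | Delete v => v \in verts G /\ v != r
  end.

(** * Input encodings

    Vertices and edges are listed without repetition, in an arbitrary order,
    and each edge with an arbitrary orientation. *)

Definition lists (I : finType) (xs : seq I) (A : {set I}) : Prop :=
  uniq xs /\ xs =i A.

Definition lists_edges (es : seq ('I_n * 'I_n)) (E : {set {set 'I_n}}) : Prop :=
  lists [seq [set e.1; e.2] | e <- es] E.

Definition code_verts (vs : seq 'I_n) : seq nat := map val vs.

Definition code_edges (es : seq ('I_n * 'I_n)) : seq nat :=
  flatten [seq [:: val e.1; val e.2] | e <- es].

Definition code_graph (m : nat) r (vs : seq 'I_n) (es : seq ('I_n * 'I_n)) :=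
  [:: n; m; val r; size vs; size es] ++ code_verts vs ++ code_edges es.

Definition code_update (o : vertex_update) : seq nat :=
  match o with
  | Insert v N => [:: 1; val v; size N] ++ code_verts N
  | Delete v => [:: 0; val v]
  end.

Definition code_active_graph (m : nat) (act : seq 'I_n)
    (es : seq ('I_n * 'I_n)) :=
  [:: n; m; size act] ++ code_verts act ++ code_edges es.

End Graphs.

(** * The two dynamic problems

    Running times are worst-case, and bounds are understood up to a constant
    factor [C] (and read as at least 1).  Words have at least
    [k * log2 (m + n + 2)] bits, for some constant [k].  In both problems
    [rep] relates the memory of the algorithm to what it represents; being
    preserved by all operations, it accounts for all operation sequences. *)

(* The graphs that may occur when [n] and [m] bound the numbers of vertices
   (the root included) and edges at all times: connectedness is what makes a
   spanning tree rooted at [r] exist. *)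
Definition rooted_graph (m n : nat) (r : 'I_n) (G : graph n) : Prop :=
  [/\ wf_graph G, r \in verts G, connected G & #|edges G| <= m].

(* [rep G T s]: the memory [s] represents the DFS tree [T] of [G]. *)
Definition maintains_dfs_tree (A : dyn_algorithm)
    (p u q : nat -> nat -> nat) : Prop :=
  exists C k : nat, forall (m n w : nat) (r : 'I_n),
    (m + n + 2) ^ k <= 2 ^ w ->
  exists rep : graph n -> ('I_n -> 'I_n) -> state -> Prop,
  [/\ forall G T s, rep G T s -> dfs_tree G r T,
      forall G vs es, rooted_graph m r G ->
        lists vs (verts G) -> lists_edges es (edges G) ->
        call w (preprocess A) (code_graph m r vs es) zero_state
          (C * (p m n).+1) (fun s => exists T, rep G T s),
      forall G T s o, rep G T s ->
        update_ok G r o -> rooted_graph m r (apply_update G o) ->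
        call w (update A) (code_update o) s
          (C * (u m n).+1) (fun s' => exists T', rep (apply_update G o) T' s') &
      forall G T s, rep G T s ->
        call w (query A) [::] s
          (C * (q m n).+1)
          (fun s' => reg s' 0 = root_children G r T /\ rep G T s')].

Definition toggle (n : nat) (S : {set 'I_n}) (v : 'I_n) : {set 'I_n} :=
  if v \in S then S :\ v else v |: S.

(* [rep S s]: the memory [s] represents the set [S] of active vertices. *)
Definition solves_subgraph_connectedness (B : dyn_algorithm)
    (p u q : nat -> nat -> nat) : Prop :=
  exists C k : nat, forall (m n w : nat) (G : graph n),
    wf_graph G -> verts G = [set: 'I_n] -> #|edges G| = m ->
    (m + n + 2) ^ k <= 2 ^ w ->
  exists rep : {set 'I_n} -> state -> Prop,
  [/\ forall S act es, lists act S -> lists_edges es (edges G) ->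
        call w (preprocess B) (code_active_graph m act es) zero_state
          (C * (p m n).+1) (rep S),
      forall S s v, rep S s ->
        call w (update B) [:: val v] s
          (C * (u m n).+1) (rep (toggle S v)) &
      forall S s, rep S s ->
        call w (query B) [::] s
          (C * (q m n).+1)
          (fun s' => reg s' 0 = connected (induced G S) /\ rep S s')].

(* Main.v *)
Require Import Defs.
From mathcomp Require Import all_boot zify.

(** Vertex 0 of [G] is turned into the root of the simulated graph, joined to
    all active vertices [W] other than 0, so that no additional vertex is
    needed.  Since a DFS tree has no cross edges, the children of the root
    correspond to the components of the graph on [W].  If 0 is itself active,
    it is contracted into an active neighbour [X], which keeps the components;
    if it has no active neighbour, it is one more component by itself.  Toggling
    a vertex [v] changes the simulated graph only at [v] and at the old and new
    [X], which are deleted and inserted again.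

    This takes O(n) time on top of six vertex updates.  That is free: a DFS
    algorithm has to receive the list of neighbours of an inserted vertex, and
    the input graph of the preprocessing, so u = Omega(n) and p = Omega(m + n).

    The DFS algorithm runs unchanged, but on registers and arrays shifted out of
    the way of those of the reduction. *)

(** Unlike preprocessing and updates, a query has no linear slack: [q] may be constant. So the pivot
    [X] and the simulated graph are kept current by the updates, and a query only adds one flag to
    the number of children of the root. The root can never be deleted, so toggling vertex 0 changes
    only its activity bit and possibly the pivot; no update is ever issued for vertex 0 itself. The
    edge bound m + n has no room to spare: contraction trades each edge at vertex 0 for at most one
    edge at [X], and the star at the root adds at most one edge per vertex. The adjacency matrix has
    quadratically many cells, more than the preprocessing could clear; it relies on memory being
    zero at the start. *)

Set Implicit Arguments.
Unset Strict Implicit.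
Unset Printing Implicit Defensive.

(** * Structured programs over a shifted copy of an algorithm *)

(* Registers below [tmp_reg] are program variables, those from [tmp_reg] up to
   [sub_reg] hold intermediate results, and register [sub_reg + x] (array
   [sub_arr + a]) stands for register [x] (array [a]) of the simulated
   algorithm. *)
Notation tmp_reg := 12.
Notation sub_reg := 24.
Notation sub_arr := 4.

Inductive expr :=
  | Num (c : nat)
  | Var (x : nat)
  | Arr (a : nat) (e : expr)
  | Op (o : binop) (e1 e2 : expr).

Record mem := Mem { rg : nat -> nat; ar : nat -> nat -> nat; sub : state }.

Definition setr M x v :=
  Mem (fun y => if y == x then v else rg M y) (ar M) (sub M).
Definition seta M a i v :=
  Mem (rg M) (fun b j => if (b == a) && (j == i) then v else ar M b j) (sub M).
Definition setsub M s := Mem (rg M) (ar M) s.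

(** Registers and arrays are functions, so without function extensionality memories reached by
    different writes can only be compared pointwise. *)
Definition state_eq (s1 s2 : state) : Prop :=
  reg s1 =1 reg s2 /\ arr s1 =2 arr s2.

Definition mem_eq (M1 M2 : mem) : Prop :=
  [/\ rg M1 =1 rg M2, ar M1 =2 ar M2 & state_eq (sub M1) (sub M2)].

(** The registers from [tmp_reg] up to [sub_reg] are left unconstrained, so evaluating an expression
    does not change the abstract memory. *)
Definition models (s : state) (M : mem) : Prop :=
  [/\ forall x, x < tmp_reg -> reg s x = rg M x,
      forall a i, a < sub_arr -> arr s a i = ar M a i,
      forall x, reg s (sub_reg + x) = reg (sub M) x &
      forall a i, arr s (sub_arr + a) i = arr (sub M) a i].

Lemma models_eq s M1 M2 : mem_eq M1 M2 -> models s M1 -> models s M2.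
Proof.
case=> rE aE [srE saE] [h1 h2 h3 h4]; split=> *.
- by rewrite h1.
- by rewrite h2.
- by rewrite h3.
- by rewrite h4.
Qed.

Fixpoint eval (M : mem) (e : expr) : nat :=
  match e with
  | Num c => c
  | Var x => rg M x
  | Arr a e => ar M a (eval M e)
  | Op o e1 e2 => eval_binop o (eval M e1) (eval M e2)
  end.

(* No intermediate result overflows a word. *)
Fixpoint fits (b : nat) (M : mem) (e : expr) : bool :=
  match e with
  | Num c => c < b
  | Var x => rg M x < b
  | Arr a e => fits b M e
  | Op o e1 e2 =>
      [&& fits b M e1, fits b M e2 &
          eval_binop o (eval M e1) (eval M e2) < b]
  end.

(** Number of consecutive temporaries occupied by [comp]: the value of a first operand is held in
    one of them while the second operand is computed. *)
Fixpoint depth (e : expr) : nat :=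
  match e with
  | Num _ | Var _ => 1
  | Arr _ e => depth e
  | Op _ e1 e2 => maxn (depth e1) (depth e2).+1
  end.

Fixpoint scoped (e : expr) : bool :=
  match e with
  | Num _ => true
  | Var x => x < tmp_reg
  | Arr a e => (a < sub_arr) && scoped e
  | Op _ e1 e2 => scoped e1 && scoped e2
  end.

Definition legal (e : expr) : bool := scoped e && (tmp_reg + depth e <= sub_reg).

Fixpoint cost (e : expr) : nat :=
  match e with
  | Num _ | Var _ => 1
  | Arr _ e => cost e + 1
  | Op _ e1 e2 => cost e1 + cost e2 + 1
  end.

(** The machine has no move instruction; the bitwise conjunction of a register with itself serves as
    one. *)
Fixpoint comp (x : nat) (e : expr) : cmd :=
  match e with
  | Num c => Const x c
  | Var y => Binop OAnd x y y
  | Arr a e => Seq (comp x e) (Get x a x)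
  | Op o e1 e2 => Seq (Seq (comp x e1) (comp x.+1 e2)) (Binop o x x x.+1)
  end.

Lemma models_set_tmp s M x v :
  tmp_reg <= x < sub_reg -> models s M -> models (set_reg s x v) M.
Proof.
move=> hx [h1 h2 h3 h4]; split=> //= y; last by rewrite ifN ?h3 //; lia.
by move=> hy; rewrite ifN ?h1 //; lia.
Qed.

(** The last clause drives the induction: as registers below the target are untouched, a first
    operand survives the computation of the second one register higher. *)
Lemma exec_comp w e x s M :
  tmp_reg <= x -> x + depth e <= sub_reg -> scoped e -> models s M ->
  fits (2 ^ w) M e ->
  exists s', [/\ exec w (comp x e) s (cost e) s', models s' M,
    reg s' x = eval M e & forall y, y < x -> reg s' y = reg s y].
Proof.
elim: e x s => [c|y|a e IH|o e1 IH1 e2 IH2] x s hx hd hsc hM /=.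
- move=> hc; exists (set_reg s x (c %% 2 ^ w)); split; first exact: ExecConst.
  + by apply: models_set_tmp; rewrite // /= in hd *; lia.
  + by rewrite /= eqxx modn_small.
  + by move=> y hy /=; rewrite ifN //; lia.
- move=> hy; exists (set_reg s x (Nat.land (reg s y) (reg s y) %% 2 ^ w)).
  split; first exact: (ExecBinop w OAnd).
  + by apply: models_set_tmp; rewrite // /= in hd *; lia.
  + case: hM => h1 _ _ _.
    by rewrite /= eqxx PeanoNat.Nat.land_diag h1 // modn_small.
  + by move=> z hz /=; rewrite ifN //; lia.
- move=> hf; move: hsc => /= /andP[ha hsc].
  have [s1 [ex1 M1 v1 f1]] := IH x s hx hd hsc hM hf.
  exists (set_reg s1 x (arr s1 a (reg s1 x))); split.
  + by apply: ExecSeq ex1 _; apply: ExecGet.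
  + apply: models_set_tmp => //; have: 0 < depth e by elim: (e) => //= *; lia.
    by move: hd => /=; lia.
  + by case: M1 => _ h2 _ _; rewrite /= eqxx h2 // v1.
  + by move=> z hz /=; rewrite ifN ?f1 //; lia.
- case/and3P=> hf1 hf2 ho; move: hsc => /= /andP[hsc1 hsc2].
  move: hd => /= hd.
  have [|s1 [ex1 M1 v1 f1]] := IH1 x s hx _ hsc1 hM hf1; first lia.
  have [||s2 [ex2 M2 v2 f2]] := IH2 x.+1 s1 _ _ hsc2 M1 hf2; try lia.
  exists (set_reg s2 x (eval_binop o (reg s2 x) (reg s2 x.+1) %% 2 ^ w)); split.
  + apply: ExecSeq (ExecBinop w o _ _ _ _).
    exact: ExecSeq ex1 ex2.
  + by apply: models_set_tmp => //; lia.
  + by rewrite /= eqxx v2 f2 // v1 modn_small.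
  + by move=> z hz /=; rewrite ifN ?f2 ?f1 //; lia.
Qed.

(* The postcondition receives an upper bound on the running time. *)
Definition run (w : nat) (c : cmd) (M : mem) (Q : nat -> mem -> Prop) : Prop :=
  forall s, models s M -> exists t s', exec w c s t s' /\
    exists b M', [/\ t <= b, models s' M' & Q b M'].

Lemma run_conseq w c M (Q Q' : nat -> mem -> Prop) :
  run w c M Q ->
  (forall b M', Q b M' -> exists b' M2, [/\ b <= b', mem_eq M' M2 & Q' b' M2]) ->
  run w c M Q'.
Proof.
move=> hc hQ s /hc[t [s' [ex [b [M' [hb hM' hq]]]]]].
have [b' [M2 [hb' he hq']]] := hQ _ _ hq.
exists t, s'; split=> //; exists b', M2; split=> //; first lia.
exact: models_eq hM'.
Qed.

Lemma run_seq w c1 c2 M Q :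
  run w c1 M (fun b1 M1 => run w c2 M1 (fun b2 M2 => Q (b1 + b2) M2)) ->
  run w (Seq c1 c2) M Q.
Proof.
move=> h s /h[t1 [s1 [ex1 [b1 [M1 [hb1 hM1 /(_ _ hM1)]]]]]].
case=> t2 [s2 [ex2 [b2 [M2 [hb2 hM2 hq]]]]].
exists (t1 + t2), s2; split; first exact: ExecSeq ex1 ex2.
by exists (b1 + b2), M2; split=> //; lia.
Qed.

Lemma run_skip w M (Q : nat -> mem -> Prop) : Q 1 M -> run w Skip M Q.
Proof.
by move=> hq s hM; exists 1, s; split; [exact: ExecSkip | exists 1, M].
Qed.

(** * Assignments, stores, conditionals and counting loops *)

Definition asg (x : nat) (e : expr) : cmd :=
  Seq (comp tmp_reg e) (Binop OAnd x tmp_reg tmp_reg).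

Definition put (a : nat) (e1 e2 : expr) : cmd :=
  Seq (Seq (comp tmp_reg e1) (comp tmp_reg.+1 e2)) (Put a tmp_reg tmp_reg.+1).

Definition ife (e : expr) (c1 c2 : cmd) : cmd :=
  Seq (comp tmp_reg e) (If tmp_reg c1 c2).

Lemma models_setr s M x v :
  x < tmp_reg -> models s M -> models (set_reg s x v) (setr M x v).
Proof.
move=> hx [h1 h2 h3 h4]; split=> //= y.
  by move=> hy; case: eqP => // _; rewrite h1.
by rewrite ifN ?h3 //; lia.
Qed.

Lemma models_seta s M a i v :
  a < sub_arr -> models s M -> models (set_arr s a i v) (seta M a i v).
Proof.
move=> ha [h1 h2 h3 h4]; split=> //= b j.
  by move=> hb; case: ifP => // _; rewrite h2.
by rewrite ifN ?h4 //; lia.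
Qed.

Lemma run_asg w x e M (Q : nat -> mem -> Prop) :
  x < tmp_reg -> legal e -> fits (2 ^ w) M e -> eval M e < 2 ^ w ->
  Q (cost e + 1) (setr M x (eval M e)) -> run w (asg x e) M Q.
Proof.
move=> hx /andP[hs hd] hf hv hq s hM.
have [s1 [ex1 M1 v1 f1]] := exec_comp (leqnn _) hd hs hM hf.
exists (cost e + 1), (set_reg s1 x (eval M e)); split.
  apply: ExecSeq ex1 _.
  have := ExecBinop w OAnd x tmp_reg tmp_reg s1.
  by rewrite v1 /= PeanoNat.Nat.land_diag modn_small.
by exists (cost e + 1), (setr M x (eval M e)); split=> //; apply: models_setr.
Qed.

Lemma exec_comp2 w e1 e2 s M :
  legal e1 -> legal (Op OAdd e1 e2) ->
  models s M -> fits (2 ^ w) M e1 -> fits (2 ^ w) M e2 ->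
  exists s', [/\ exec w (Seq (comp tmp_reg e1) (comp tmp_reg.+1 e2)) s
      (cost e1 + cost e2) s', models s' M,
    reg s' tmp_reg = eval M e1 & reg s' tmp_reg.+1 = eval M e2].
Proof.
case/andP=> hs1 hd1 /andP[/=/andP[_ hs2] hd2] hM hf1 hf2.
have [s1 [ex1 M1 v1 f1]] := exec_comp (leqnn _) hd1 hs1 hM hf1.
have [||s2 [ex2 M2 v2 f2]] :=
  @exec_comp w e2 tmp_reg.+1 s1 M _ _ hs2 M1 hf2; try lia.
exists s2; split=> //; first exact: ExecSeq ex1 ex2.
by rewrite f2.
Qed.

Lemma run_put w a e1 e2 M (Q : nat -> mem -> Prop) :
  a < sub_arr -> legal e1 -> legal (Op OAdd e1 e2) ->
  fits (2 ^ w) M e1 -> fits (2 ^ w) M e2 ->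
  Q (cost e1 + cost e2 + 1) (seta M a (eval M e1) (eval M e2)) ->
  run w (put a e1 e2) M Q.
Proof.
move=> ha hl1 hl2 hf1 hf2 hq s hM.
have [s2 [ex2 M2 v1 v2]] := exec_comp2 hl1 hl2 hM hf1 hf2.
exists (cost e1 + cost e2 + 1), (set_arr s2 a (eval M e1) (eval M e2)); split.
  by rewrite -v1 -v2; apply: ExecSeq ex2 (ExecPut _ _ _ _ _).
exists (cost e1 + cost e2 + 1), (seta M a (eval M e1) (eval M e2)).
by split=> //; apply: models_seta.
Qed.

Lemma run_ife w e c1 c2 M (Q : nat -> mem -> Prop) :
  legal e -> fits (2 ^ w) M e ->
  (eval M e <> 0 -> run w c1 M (fun b => Q (cost e + b.+1))) ->
  (eval M e = 0 -> run w c2 M (fun b => Q (cost e + b.+1))) ->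
  run w (ife e c1 c2) M Q.
Proof.
move=> /andP[hs hd] hf hq1 hq2 s hM.
have [s1 [ex1 M1 v1 f1]] := exec_comp (leqnn _) hd hs hM hf.
have : run w (if eval M e != 0 then c1 else c2) M (fun b => Q (cost e + b.+1)).
  by case: eqP => /= [/hq2|/hq1].
case/(_ _ M1) => t [s2 [ex2 [b [M2 [hb hM2 q]]]]].
exists (cost e + t.+1), s2; split.
  by apply: ExecSeq ex1 _; apply: ExecIf; rewrite v1.
by exists (cost e + b.+1), M2; split=> //; lia.
Qed.

Definition for_ (i h : nat) (c : cmd) : cmd :=
  let test := comp tmp_reg (Op OLt (Var i) (Var h)) in
  Seq (asg i (Num 0))
    (Seq test
      (While tmp_reg (Seq c (Seq (asg i (Op OAdd (Var i) (Num 1))) test)))).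

(* [F k] is the memory when the loop variable has just received [k]. *)
Lemma run_for w i h c b (F : nat -> mem) (hi : nat) M (Q : nat -> mem -> Prop) :
  i < tmp_reg -> h < tmp_reg -> i != h -> hi.+1 < 2 ^ w ->
  mem_eq (setr M i 0) (F 0) ->
  (forall k, k <= hi -> rg (F k) h = hi /\ rg (F k) i = k) ->
  (forall k, k < hi -> run w c (F k) (fun b' M' =>
     [/\ b' <= b, rg M' i = k & mem_eq (setr M' i k.+1) (F k.+1)])) ->
  Q (6 + hi * (b + 8)) (F hi) ->
  run w (for_ i h c) M Q.
Proof.
move=> li lh nih hw hF0 hF hc hq.
set e := Op OLt (Var i) (Var h).
have le : legal e by rewrite /legal /= li lh.
have fe k : k <= hi -> fits (2 ^ w) (F k) e.
  by move=> hk /=; have [-> ->] := hF _ hk; case: ltnP => /=; lia.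
have ve k : k <= hi -> eval (F k) e = (k < hi).
  by move=> hk /=; have [-> ->] := hF _ hk.
have test k s : k <= hi -> models s (F k) -> exists s1,
   [/\ exec w (comp tmp_reg e) s 3 s1, models s1 (F k) &
     reg s1 tmp_reg = (k < hi)].
  move=> hk hM; case/andP: le => hs hd.
  have [s1 [ex1 M1 v1 f1]] := exec_comp (leqnn _) hd hs hM (fe _ hk).
  by exists s1; split=> //; rewrite v1 ve.
(* Induction on the number [d] of rounds left. A round costs [b] for the body, 4 for the increment,
   3 for the test and 1 for the loop itself; leaving the loop costs 1. *)
have loop d k s : k + d = hi -> models s (F k) -> reg s tmp_reg = (k < hi) ->
  exists t s', [/\ exec w (While tmp_reg
      (Seq c (Seq (asg i (Op OAdd (Var i) (Num 1))) (comp tmp_reg e)))) s t s',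
    t <= 1 + d * (b + 8) & models s' (F hi)].
  elim: d k s => [|d IH] k s hk hM hr.
    exists 1, s; split=> //; last by move: hk; rewrite addn0 => <-.
    by apply: ExecWhileEnd; rewrite hr; case: ltnP => //; lia.
  have ltk : k < hi by lia.
  have [t1 [s1 [ex1 [b1 [M1 [hb1 hM1 [lb1 hi1 he1]]]]]]] := hc k ltk s hM.
  have hrun : run w (asg i (Op OAdd (Var i) (Num 1))) M1
      (fun b' M' => b' = 4 /\ M' = setr M1 i k.+1).
    apply: run_asg => //=; rewrite ?hi1 ?addn1 //; first by rewrite /legal /= li.
      by lia.
    by lia.
  have [t2 [s2 [ex2 [b2 [M2 [hb2 hM2 [hb2' hM2']]]]]]] := hrun s1 hM1.
  have hM2F : models s2 (F k.+1) by apply: models_eq hM2; rewrite hM2'.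
  have [s3 [ex3 hM3 hr3]] := test k.+1 s2 ltk hM2F.
  have [|t4 [s4 [ex4 ht4 hM4]]] := IH k.+1 s3 _ hM3 hr3; first lia.
  exists (t1 + (t2 + 3) + t4).+1, s4; split=> //.
    apply: ExecWhileLoop ex4; first by rewrite hr ltk.
    by apply: ExecSeq ex1 _; apply: ExecSeq ex2 ex3.
  by rewrite mulSn; lia.
move=> s hM.
have hrun : run w (asg i (Num 0)) M (fun b' M' => b' = 2 /\ M' = setr M i 0).
  by apply: run_asg => //=; lia.
have [t2 [s2 [ex2 [b2 [M2 [hb2 hM2 [hb2' hM2']]]]]]] := hrun s hM.
have hM2F : models s2 (F 0) by apply: models_eq hM2; rewrite hM2'.
have [s3 [ex3 hM3 hr3]] := test 0 s2 (leq0n _) hM2F.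
have [t4 [s4 [ex4 ht4 hM4]]] := loop hi 0 s3 (add0n _) hM3 hr3.
exists (t2 + (3 + t4)), s4; split.
  by apply: ExecSeq ex2 _; apply: ExecSeq ex3 ex4.
by exists (6 + hi * (b + 8)), (F hi); split=> //; lia.
Qed.

(** * Running the simulated algorithm in the shifted part of the memory *)

Fixpoint shift (c : cmd) : cmd :=
  match c with
  | Skip => Skip
  | Const x c => Const (sub_reg + x) c
  | Binop o x y z => Binop o (sub_reg + x) (sub_reg + y) (sub_reg + z)
  | Get x a y => Get (sub_reg + x) (sub_arr + a) (sub_reg + y)
  | Put a x y => Put (sub_arr + a) (sub_reg + x) (sub_reg + y)
  | Seq c1 c2 => Seq (shift c1) (shift c2)
  | If x c1 c2 => If (sub_reg + x) (shift c1) (shift c2)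
  | While x c => While (sub_reg + x) (shift c)
  end.

Lemma models_sub_reg s M x v : models s M ->
  models (set_reg s (sub_reg + x) v) (setsub M (set_reg (sub M) x v)).
Proof.
case=> h1 h2 h3 h4; split=> //= y; last by rewrite eqn_add2l h3.
by move=> hy; rewrite ifN ?h1 //; lia.
Qed.

Lemma models_sub_arr s M a i v : models s M ->
  models (set_arr s (sub_arr + a) i v) (setsub M (set_arr (sub M) a i v)).
Proof.
case=> h1 h2 h3 h4; split=> //= b j; last by rewrite eqn_add2l h4.
by move=> hb; rewrite ifN ?h2 //; lia.
Qed.

(** Shifted names never meet those of the reduction, so every step acts on the component [sub] alone
    and takes the same time as in the original run. *)
Lemma exec_shift w c s t s' : exec w c s t s' ->
  forall M z, models z M -> sub M = s ->
  exists z', exec w (shift c) z t z' /\ models z' (setsub M s').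
Proof.
elim=> {c s t s'}.
- by move=> s [? ? ?] z hz /= <-; exists z; split=> //; apply: ExecSkip.
- move=> x c s M z hz <-; eexists; split; first exact: ExecConst.
  exact: models_sub_reg.
- move=> o x y z s M z' hz <-; eexists; split; first exact: ExecBinop.
  by case: (hz) => _ _ h3 _; rewrite !h3; apply: models_sub_reg.
- move=> x a y s M z hz <-; eexists; split; first exact: ExecGet.
  by case: (hz) => _ _ h3 h4; rewrite h3 h4; apply: models_sub_reg.
- move=> a x y s M z hz <-; eexists; split; first exact: ExecPut.
  by case: (hz) => _ _ h3 _; rewrite !h3; apply: models_sub_arr.
- move=> c1 c2 s1 t1 s2 t2 s3 _ IH1 _ IH2 M z hz hs.
  have [z1 [ex1 hz1]] := IH1 _ _ hz hs.
  have [z2 [ex2 hz2]] := IH2 _ _ hz1 erefl.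
  by exists z2; split=> //; apply: ExecSeq ex1 ex2.
- move=> x c1 c2 s t s' _ IH M z hz hs.
  have [z1 [ex1 hz1]] := IH _ _ hz hs.
  exists z1; split=> //; apply: ExecIf.
  by case: hz => _ _ -> _; rewrite hs; case: ifP ex1.
- move=> x c s hx M z hz hs; exists z; split; last by case: M hz hs => ? ? ? /= ? <-.
  by apply: ExecWhileEnd; case: hz => _ _ -> _; rewrite hs.
- move=> x c s t1 s1 t2 s2 hx _ IH1 _ IH2 M z hz hs.
  have [z1 [ex1 hz1]] := IH1 _ _ hz hs.
  have [z2 [ex2 hz2]] := IH2 _ _ hz1 erefl.
  exists z2; split=> //; apply: ExecWhileLoop ex1 ex2.
  by case: hz => _ _ -> _; rewrite hs.
Qed.

Lemma run_shift w c xs a b P M (Q : nat -> mem -> Prop) :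
  sub M = feed xs a -> call w c xs a b P ->
  (forall a', P a' -> Q b (setsub M a')) -> run w (shift c) M Q.
Proof.
move=> hM [t [s' [ex hb hP]]] hQ z hz.
have [z' [ex' hz']] := exec_shift ex hz hM.
exists t, z'; split=> //; exists b, (setsub M s'); split=> //; first lia.
exact: hQ.
Qed.

(* The length register of the simulated call doubles as a stack pointer. *)
Definition open_call : cmd := Const sub_reg 0.
Definition push (e : expr) : cmd :=
  Seq (Seq (comp tmp_reg e) (Put sub_arr sub_reg tmp_reg))
    (Seq (Const tmp_reg 1) (Binop OAdd sub_reg sub_reg tmp_reg)).
(** The length of a list precedes it in the encoding but is known only after the list has been
    emitted: a placeholder is pushed first and overwritten later. *)
Definition poke (c : nat) (e : expr) : cmd :=
  Seq (Seq (comp tmp_reg (Num c)) (comp tmp_reg.+1 e))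
    (Put sub_arr tmp_reg tmp_reg.+1).
Definition get_length (x : nat) : cmd := Binop OAnd x sub_reg sub_reg.

Lemma run_open_call w M (Q : nat -> mem -> Prop) :
  Q 1 (setsub M (feed [::] (sub M))) -> run w open_call M Q.
Proof.
move=> hq s hM; exists 1, (set_reg s sub_reg (0 %% 2 ^ w)).
split; first exact: ExecConst.
exists 1, (setsub M (feed [::] (sub M))); split=> //.
apply: models_eq (models_sub_reg 0 (0 %% 2 ^ w) hM); split=> //; split=> [y|b j] /=.
  by rewrite mod0n.
by rewrite andbF.
Qed.

(** The words pushed so far are kept as an overlay [feed xs a] over the memory [a] left by the
    previous call. Once complete, this is literally the memory in which [call] starts. *)
Lemma run_push w e xs a M (Q : nat -> mem -> Prop) :
  legal e -> fits (2 ^ w) M e -> sub M = feed xs a -> (size xs).+1 < 2 ^ w ->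
  Q (cost e + 3) (setsub M (feed (rcons xs (eval M e)) a)) ->
  run w (push e) M Q.
Proof.
move=> /andP[hs hd] hf hM hsz hq s hsM.
have [s1 [ex1 M1 v1 f1]] := exec_comp (leqnn _) hd hs hsM hf.
set s2 := set_arr s1 sub_arr (reg s1 sub_reg) (reg s1 tmp_reg).
set s3 := set_reg s2 tmp_reg (1 %% 2 ^ w).
set s4 := set_reg s3 sub_reg ((reg s3 sub_reg + reg s3 tmp_reg) %% 2 ^ w).
exists (cost e + 1 + (1 + 1)), s4; split.
  apply: ExecSeq (ExecSeq (ExecConst _ _ _ _) (ExecBinop w OAdd _ _ _ _)).
  exact: ExecSeq ex1 (ExecPut _ _ _ _ _).
exists (cost e + 3), (setsub M (feed (rcons xs (eval M e)) a)); split=> //.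
  by lia.
have hr : reg s1 sub_reg = size xs.
  by case: M1 => _ _ /(_ 0) -> _; rewrite hM.
have m2 : models s2 (setsub M (set_arr (sub M) 0 (size xs) (eval M e))).
  by rewrite /s2 hr v1; apply: (models_sub_arr 0).
have m3 : models s3 (setsub M (set_arr (sub M) 0 (size xs) (eval M e))).
  exact: models_set_tmp.
have := models_sub_reg 0 ((reg s3 sub_reg + reg s3 tmp_reg) %% 2 ^ w) m3.
apply: models_eq; split=> //; split=> [y|b j] /=.
  rewrite hM /= hr size_rcons; case: eqP => // _.
  by rewrite (@modn_small 1) ?addn1 ?modn_small //; lia.
rewrite hM /= size_rcons nth_rcons.
case: (b == 0) => //=; case: (ltngtP j (size xs)) => [h|h|->].
- by rewrite ltnS ltnW.
- by rewrite ltnS leqNgt h.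
- by rewrite ltnSn.
Qed.

Lemma run_poke w c e xs a M (Q : nat -> mem -> Prop) :
  legal (Op OAdd (Num c) e) -> fits (2 ^ w) M e -> c < 2 ^ w ->
  sub M = feed xs a -> c < size xs ->
  Q (cost e + 2) (setsub M (feed (set_nth 0 xs c (eval M e)) a)) ->
  run w (poke c e) M Q.
Proof.
move=> hl hf hc hM hsz hq s hsM.
have [s2 [ex2 M2 v1 v2]] := exec_comp2 (isT : legal (Num c)) hl hsM hc hf.
exists (cost (Num c) + cost e + 1), (set_arr s2 sub_arr c (eval M e)); split.
  rewrite -[X in set_arr _ _ X](v1) -v2.
  exact: ExecSeq ex2 (ExecPut _ _ _ _ _).
exists (cost e + 2), (setsub M (feed (set_nth 0 xs c (eval M e)) a)); split=> //.
  by rewrite /=; lia.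
apply: models_eq (models_sub_arr 0 c (eval M e) M2); split=> //.
have hs : size (set_nth 0 xs c (eval M e)) = size xs.
  by rewrite size_set_nth; apply/maxn_idPr.
split=> [y|b j] /=; rewrite hM /= hs // nth_set_nth /=.
by case: (b == 0) => //=; case: eqP => // ->; rewrite hsz.
Qed.

Lemma run_get_length w x M (Q : nat -> mem -> Prop) :
  x < tmp_reg -> reg (sub M) 0 < 2 ^ w ->
  Q 1 (setr M x (reg (sub M) 0)) -> run w (get_length x) M Q.
Proof.
move=> hx hw hq s hM; exists 1, (set_reg s x (reg (sub M) 0)); split.
  have := ExecBinop w OAnd x sub_reg sub_reg s.
  case: hM => _ _ /(_ 0) /= h _.
  by rewrite /get_length /= h PeanoNat.Nat.land_diag modn_small.
by exists 1, (setr M x (reg (sub M) 0)); split=> //; apply: models_setr.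
Qed.

Lemma eval_setsub M s e : eval (setsub M s) e = eval M e.
Proof. by elim: e => //= [a e ->|o e1 -> e2 ->]. Qed.

Lemma fits_setsub b M s e : fits b (setsub M s) e = fits b M e.
Proof. by elim: e => //= o e1 -> e2 ->; rewrite !eval_setsub. Qed.

Definition pushes (es : seq expr) : cmd := foldr (fun e c => Seq (push e) c) Skip es.
Definition pushes_cost (es : seq expr) : nat := foldr (fun e n => cost e + 3 + n) 1 es.

Lemma run_pushes w es xs a M (Q : nat -> mem -> Prop) :
  all legal es -> all (fits (2 ^ w) M) es -> sub M = feed xs a ->
  size xs + size es < 2 ^ w ->
  Q (pushes_cost es) (setsub M (feed (xs ++ [seq eval M e | e <- es]) a)) ->
  run w (pushes es) M Q.
Proof.
elim: es xs M Q => [|e es IH] xs M Q /=.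
  move=> _ _ hM _ hq; apply: run_skip; move: hq; rewrite cats0 -hM.
  by case: M hM.
move=> /andP[le les] /andP[fe fes] hM hsz hq.
apply: run_seq; apply: (run_push le fe hM); first lia.
apply: (IH (rcons xs (eval M e))) => //.
- by apply: sub_all fes => e' h; rewrite fits_setsub.
- by rewrite size_rcons; lia.
- rewrite -cats1 -catA /=.
  by rewrite (eq_map (fun e' => eval_setsub M _ e')).
Qed.

Definition emit (i h : nat) (c : expr) (es : seq expr) : cmd :=
  for_ i h (ife c (pushes es) Skip).

(** [L] is a ghost list that the program never sees, and [f y] is the block of words contributed by
    its entry [y]. This treats ranges of vertices and lists of edges alike. *)
Lemma run_emit T (L : seq T) (f : T -> seq nat) w i h c es xs a M
    (Q : nat -> mem -> Prop) :
  i < tmp_reg -> h < tmp_reg -> i != h -> legal c -> all legal es ->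
  sub M = feed xs a -> rg M h = size L -> (size L).+1 < 2 ^ w ->
  size (xs ++ flatten (map f L)) < 2 ^ w ->
  (forall k y, onth L k = Some y ->
    [/\ fits (2 ^ w) (setr M i k) c,
        eval (setr M i k) c != 0 -> all (fits (2 ^ w) (setr M i k)) es &
        f y = if eval (setr M i k) c != 0 then map (eval (setr M i k)) es
              else [::]]) ->
  Q (6 + size L * (cost c + pushes_cost es + 10))
    (setsub (setr M i (size L)) (feed (xs ++ flatten (map f L)) a)) ->
  run w (emit i h c es) M Q.
Proof.
move=> li lh nih lc les hM hL hw hsz hbody hq.
pose F k := setsub (setr M i k) (feed (xs ++ flatten (map f (take k L))) a).
apply: (@run_for w i h _ (cost c + pushes_cost es + 2) F (size L)) => //.
- split=> //=; rewrite take0 /= cats0 hM; by split.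
- by move=> k hk /=; rewrite eqxx [h == i]eq_sym (negbTE nih).
- move=> k hk; move: (hk); rewrite -onthTE; case hy: (onth L k) => [y|] // _.
  have takeE : take k.+1 L = rcons (take k L) y.
    by rewrite (take_nth y hk) (onth_nth y _ _ _ hy).
  have hszk : size (xs ++ flatten (map f (take k L))) + size (f y) < 2 ^ w.
    apply: leq_ltn_trans hsz; rewrite -{2}(cat_take_drop k.+1 L) takeE.
    rewrite map_cat map_rcons -cats1 !flatten_cat /= cats0 !size_cat; lia.
  have [fc fes fyE] := hbody _ _ hy.
  have eF e : eval (F k) e = eval (setr M i k) e by rewrite eval_setsub.
  apply: run_ife => //; first by rewrite fits_setsub.
  + rewrite eF => /eqP hc; move: fyE; rewrite hc => fyE.
    apply: (run_pushes les) (erefl : sub (F k) = feed _ _) _ _.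
    * by apply: sub_all (fes hc) => e he; rewrite fits_setsub.
    * by move: hszk; rewrite fyE size_map.
    split; [lia | by rewrite /= eqxx | split=> //=].
    - by move=> z /=; case: eqP.
    - rewrite (eq_map eF) -fyE takeE map_rcons -cats1 flatten_cat /= cats0 catA.
      by split.
  + rewrite eF => hc; move: fyE; rewrite hc /= => fyE.
    apply: run_skip; split; [lia | by rewrite /= eqxx | split=> //=].
    - by move=> z /=; case: eqP.
    - by rewrite takeE map_rcons -cats1 flatten_cat /= fyE !cats0; split.
- rewrite /F take_size; congr (Q (6 + size L * _) _): hq; lia.
Qed.

(** * The simulated graphs *)

Section PairSets.

Variable T : finType.
Implicit Types a b c d : T.

Lemma set2_eq a b c d :
  [set a; b] = [set c; d] -> (a = c /\ b = d) \/ (a = d /\ b = c).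
Proof.
move=> h; have ha : a \in [set c; d] by rewrite -h set21.
have hb : b \in [set c; d] by rewrite -h set22.
have hc : c \in [set a; b] by rewrite h set21.
have hd : d \in [set a; b] by rewrite h set22.
move: ha hb hc hd; rewrite !inE.
case/orP=> /eqP->; case/orP=> /eqP->; rewrite ?orbb; auto.
- by move=> _ /eqP->; auto.
- by move=> /eqP->; auto.
Qed.

Lemma set2_inj a b c : [set a; b] = [set a; c] -> b = c.
Proof. by case/set2_eq => [[_ //]|[-> ->]]. Qed.

(** Encodings consist of oriented pairs; this is why every well-formed graph has one. *)
Lemma orient_edges (s : seq {set T}) : (forall e, e \in s -> #|e| = 2) ->
  exists es : seq (T * T), [seq [set e.1; e.2] | e <- es] = s.
Proof.
elim: s => [|e s IH] he; first by exists [::].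
have [|es <-] := IH; first by move=> e' h; apply: he; rewrite inE h orbT.
have /eqP/cards2P[a [b [_ ->]]] := he e (mem_head _ _).
by exists ((a, b) :: es).
Qed.

End PairSets.

(** * Subgraphs of a fixed relation *)

Section RelGraph.

Variable n : nat.
Implicit Types (V W : {set 'I_n}) (E : rel 'I_n).

(** With [E] fixed, deleting a vertex, or inserting one together with all its [E]-neighbours,
    changes nothing but [V]; the simulated graph is then determined by its vertex set and the
    pivot. *)
Definition rel_graph V E : graph n :=
  Graph V [set [set p.1; p.2] | p : 'I_n * 'I_n &
             [&& p.1 \in V, p.2 \in V, p.1 != p.2 & E p.1 p.2]].

Lemma rel_graph_edgeP V E (e : {set 'I_n}) :
  reflect (exists a b, [/\ e = [set a; b], a \in V, b \in V, a != b & E a b])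
    (e \in edges (rel_graph V E)).
Proof.
apply: (iffP imsetP) => [[[a b]]|[a [b [-> ha hb hab hE]]]].
  by rewrite inE => /and4P[ha hb hab hE] ->; exists a, b.
by exists (a, b); rewrite // inE /=; apply/and4P.
Qed.

Lemma adj_rel_graph V E a b : symmetric E ->
  adj (rel_graph V E) a b = [&& a \in V, b \in V, a != b & E a b].
Proof.
move=> Esym; apply/rel_graph_edgeP/and4P => [[c [d [h hc hd hcd hE]]]|[*]].
  by case/set2_eq: h => [[-> ->]|[-> ->]]; split; rewrite // 1?eq_sym // Esym.
by exists a, b.
Qed.

Lemma wf_rel_graph V E : wf_graph (rel_graph V E).
Proof.
move=> e /rel_graph_edgeP[a [b [-> ha hb hab _]]].
rewrite cards2 hab; split=> //; apply/subsetP=> x.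
by rewrite !inE => /orP[]/eqP->.
Qed.

Lemma rel_graph_eq V E E' : {in V &, E =2 E'} -> rel_graph V E = rel_graph V E'.
Proof.
move=> h; congr Graph; apply/setP=> e.
by apply/(rel_graph_edgeP V E)/(rel_graph_edgeP V E');
  move=> [a [b [-> ha hb hab hE]]]; exists a, b; split; rewrite // ?h // -h.
Qed.

Lemma rel_graph_delete V E v :
  apply_update (rel_graph V E) (Delete v) = rel_graph (V :\ v) E.
Proof.
congr Graph; apply/setP=> e; rewrite inE; apply/andP/rel_graph_edgeP.
  case=> /rel_graph_edgeP[a [b [-> ha hb hab hE]]]; rewrite !inE negb_or => /andP[va vb].
  by exists a, b; split=> //; rewrite !inE 1?eq_sym ?va ?vb.
case=> a [b [-> ]]; rewrite !inE => /andP[va ha] /andP[vb hb] hab hE.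
split; last by rewrite negb_or !(eq_sym v) va.
by apply/rel_graph_edgeP; exists a, b.
Qed.

Lemma rel_graph_insert V E v (N : seq 'I_n) : symmetric E -> v \notin V ->
  (forall x, (x \in N) = (x \in V) && E v x) ->
  apply_update (rel_graph V E) (Insert v N) = rel_graph (v |: V) E.
Proof.
move=> Esym hv hN; congr Graph; apply/setP=> e; rewrite inE.
apply/orP/rel_graph_edgeP => [[|]|].
- case/rel_graph_edgeP=> a [b [-> ha hb hab hE]].
  by exists a, b; split=> //; rewrite inE ?ha ?hb orbT.
- case/imsetP=> x; rewrite hN => /andP[hx hE] ->.
  exists v, x; split=> //; rewrite ?inE ?eqxx ?hx ?orbT //.
  by apply: contraNneq hv => ->.
- case=> a [b [->]]; rewrite !inE => /orP[/eqP->|ha] /orP[/eqP->|hb] hab hE.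
  + by rewrite eqxx in hab.
  + by right; apply/imsetP; exists b; rewrite // hN hb.
  + right; apply/imsetP; exists a; last by rewrite setUC.
    by rewrite hN ha Esym.
  + by left; apply/rel_graph_edgeP; exists a, b.
Qed.

Lemma rel_graph_rooted V E r m : symmetric E -> r \in V -> (forall x, E r x) ->
  #|edges (rel_graph V E)| <= m -> rooted_graph m r (rel_graph V E).
Proof.
move=> Esym hr hE hm; split=> //; first exact: wf_rel_graph.
have toroot x : x \in V -> connect (adj (rel_graph V E)) r x.
  move=> hx; case: (eqVneq r x) => [->|nx]; first exact: connect0.
  by apply: connect1; rewrite adj_rel_graph // hr hx nx /=.
have csym : connect_sym (adj (rel_graph V E)).
  by apply: sym_connect_sym => x y; rewrite /adj setUC.
apply/forall_inP => x hx; apply/forall_inP => y hy.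
by apply: connect_trans (toroot y hy); rewrite csym; apply: toroot.
Qed.

End RelGraph.

(** * Children of the root versus components off the root *)

Section RootChildren.

Variables (n : nat) (G : graph n) (r : 'I_n) (T : 'I_n -> 'I_n).
Hypotheses (wfG : wf_graph G) (dfsT : dfs_tree G r T).

Definition off_root : rel 'I_n := fun x y => [&& x != r, y != r & adj G x y].

Lemma off_root_sym : symmetric off_root.
Proof. by move=> x y; rewrite /off_root /adj setUC andbCA. Qed.

(** Climb from [x] to the last vertex before [r]; all tree edges used on the way avoid [r]. *)
Lemma root_child_above x : x \in verts G -> x != r ->
  exists c, [/\ c \in verts G, c != r, T c = r & connect off_root x c].
Proof.
case: dfsT => _ [_ adjT reachT] _ hx xr.
have /iter_findex := reachT x hx; move: (findex T x r) => k.
elim: k x hx xr => [|k IH] x hx xr; first by move=> /= h; rewrite h eqxx in xr.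
rewrite iterSr => hk; case: (eqVneq (T x) r) => [Txr|Txr].
  by exists x; split=> //; apply: connect0.
have adjx := adjT x hx xr.
have [|c [hc cr Tc con]] := IH (T x) _ Txr hk.
  by have [_ /subsetP h] := wfG adjx; apply: h; rewrite set22.
exists c; split=> //; apply: connect_trans con; apply: connect1.
by rewrite /off_root xr Txr.
Qed.

(** Here the absence of cross edges enters: one end of the edge is an ancestor of the other, so both
    hang below the same child of the root. *)
Lemma below_root_child c x y : T c = r -> off_root x y ->
  fconnect T x c = fconnect T y c.
Proof.
case: dfsT => _ [Tr _ _] anc Tc.
have iter_r k : iter k T r = r by elim: k => //= k ->.
(* Both [b] and [c] lie on the way up from [a]. If [c] came strictly before [b], the next vertex
   would already be [r], where the iteration stays, forcing [b = r]. *)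
have below a b : b != r -> fconnect T a b -> fconnect T a c = fconnect T b c.
  move=> br ab; apply/idP/idP; last exact: connect_trans.
  move=> /iter_findex; move/iter_findex: ab.
  move: (findex T a b) (findex T a c) => j i hj hi.
  case: (leqP j i) => ij.
    by rewrite -hi -(subnK ij) iterD hj fconnect_iter.
  move: br; rewrite -hj -(subnK ij) iterD iterS hi Tc iter_r eqxx //.
case/and3P=> xr yr xy.
case: (eqVneq (T x) y) => [Txy|nxy].
  by apply: below; rewrite // -Txy fconnect1.
case: (eqVneq (T y) x) => [Tyx|nyx].
  by symmetry; apply: below; rewrite // -Tyx fconnect1.
by case: (anc x y xy nxy nyx) => [/below->//|/below->].
Qed.

(** Every vertex off the root is connected to a child of the root, and the subtree of a child is
    closed under edges avoiding the root; so the subtrees of the children are exactly the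
    components. *)
Lemma root_children_le1 :
  reflect {in verts G :\ r &, forall x y, connect off_root x y}
    (root_children G r T <= 1).
Proof.
apply: (iffP idP) => [/card_le1_eqP h x y|h].
  rewrite !inE => /andP[xr hx] /andP[yr hy].
  have [c [hc cr Tc con]] := root_child_above hx xr.
  have [c' [hc' cr' Tc' con']] := root_child_above hy yr.
  have cc : c = c' by apply: h; rewrite inE ?hc ?hc' ?cr ?cr' ?Tc ?Tc' ?eqxx.
  apply: connect_trans con _.
  by rewrite cc (sym_connect_sym off_root_sym).
apply/card_le1_eqP => c c'; rewrite !inE.
move=> /and3P[hc cr /eqP Tc] /and3P[hc' cr' /eqP Tc'].
have /connectP[p] : connect off_root c c' by apply: h; rewrite inE ?hc ?hc' ?inE ?cr ?cr'.
have same q x : path off_root x q -> fconnect T x c = fconnect T (last x q) c.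
  by elim: q x => //= y q IH x /andP[xy /IH <-]; apply: below_root_child.
(* Being below [c] is invariant along the path, so [c] is an ancestor of [c']. But the only proper
   ancestor of [c'] is [r], hence [c = c']. *)
move=> /same + lc; rewrite -lc connect0 => /esym/iter_findex.
case: dfsT => _ [Tr _ _] _.
have iter_r k : iter k T r = r by elim: k => //= k ->.
case: (findex T c' c) => [//|k]; rewrite iterSr Tc' iter_r => rc.
by rewrite rc eqxx in cr.
Qed.

Lemma root_children_eq0 : (root_children G r T == 0) = (verts G == [set r]).
Proof.
case: (dfsT) => hr _ _; rewrite cards_eq0; apply/eqP/eqP => [h0|hV].
  apply/setP=> x; rewrite inE; case: (eqVneq x r) => [->//|xr].
  apply/negbTE/negP=> hx; have [c [hc cr Tc _]] := root_child_above hx xr.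
  by move/setP/(_ c): h0; rewrite !inE hc cr Tc eqxx.
by apply/setP=> x; rewrite !inE hV inE; case: eqP.
Qed.

End RootChildren.

(** * Contraction of vertex 0, its component count and its encoding *)

Section Contraction.

Variables (n : nat) (G : graph n.+1).
Hypotheses (wfG : wf_graph G) (vertsG : verts G = [set: 'I_n.+1]).
Implicit Types (S W : {set 'I_n.+1}) (X : 'I_n.+1).

Lemma adj_sym : symmetric (adj G).
Proof. by move=> x y; rewrite /adj setUC. Qed.

Lemma adj_irr x : adj G x x = false.
Proof.
apply/negP=> /wfG[]; rewrite setUid cards1 => //.
Qed.

(* Vertex [ord0] serves as the root; as a vertex of [G], it is contracted into
   its neighbour [X]. *)
Definition contracted X : rel 'I_n.+1 := fun a b =>
  [|| a == ord0, b == ord0, adj G a b, (a == X) && adj G ord0 b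
    | (b == X) && adj G ord0 a].

Definition contraction X W : graph n.+1 :=
  rel_graph (ord0 |: W) (contracted X).

(** The value [ord0] encodes that there is no pivot: the last two clauses of [contracted] then add
    no edge. It is allowed only if vertex 0 is inactive or has no active neighbour. *)
Definition pivot S X : bool :=
  if X == ord0 then (ord0 \in S) ==> [forall y in S, ~~ adj G ord0 y]
  else [&& ord0 \in S, X \in S & adj G ord0 X].

Lemma contracted_sym X : symmetric (contracted X).
Proof.
move=> a b; rewrite /contracted (adj_sym a b) orbCA; do 3!congr (_ || _).
exact: orbC.
Qed.

(** Edges of [G] avoiding vertex 0 are charged to themselves ([A]) and an edge from [X] to [y]
    created by contraction to the edge of [G] from 0 to [y] ([C]). Only the star at the root ([D])
    is in excess. *)
Lemma card_contraction X W : ord0 \notin W ->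
  #|edges (contraction X W)| <= #|edges G| + #|W|.
Proof.
move=> h0; set A := [set e in edges G | ord0 \notin e].
set B := [set e in edges G | ord0 \in e].
have -> : #|edges G| = #|A| + #|B|.
  have := cardsID [set e : {set 'I_n.+1} | ord0 \in e] (edges G).
  move=> <-; rewrite addnC; congr (_ + _); apply: eq_card => e; rewrite !inE.
    by rewrite andbC.
  by [].
set C := [set (X |: (e :\ ord0)) | e in B].
set D := [set [set ord0; y] | y in W].
have sub : edges (contraction X W) \subset A :|: C :|: D.
  apply/subsetP=> e /rel_graph_edgeP[a [b [-> ]]].
  have star y : y \in W -> [set ord0; y] \in D by apply: imset_f.
  have image y : y != ord0 -> adj G ord0 y -> [set X; y] \in C.
    move=> y0 h; apply/imsetP; exists [set ord0; y].
      by rewrite inE -/(adj G ord0 y) h set21.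
    congr (_ |: _); apply/setP=> z; rewrite !inE.
    by case: (eqVneq z ord0) => [->|]; rewrite //= eq_sym (negbTE y0).
  rewrite !in_setU !in_set1; case: (eqVneq a ord0) => [->|a0] /=.
    move=> _; case: (eqVneq b ord0) => [->//|b0] /= hb _ _.
    by rewrite star ?orbT.
  move=> ha; case: (eqVneq b ord0) => [->|b0] /= hb ab.
    by rewrite setUC star ?orbT.
  rewrite /contracted (negbTE a0) (negbTE b0) /=.
  case/or3P=> [h|/andP[/eqP-> h]|/andP[/eqP-> h]].
  - by rewrite inE -/(adj G a b) h !inE negb_or !(eq_sym ord0) a0 b0.
  - by rewrite image ?orbT.
  - by rewrite setUC image ?orbT.
apply: leq_trans (subset_leq_card sub) _.
apply: leq_trans (leq_card_setU _ _) _.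
apply: leq_add; last exact: leq_imset_card.
apply: leq_trans (leq_card_setU _ _) _.
by rewrite leq_add2l; apply: leq_imset_card.
Qed.

Lemma contraction_rooted X W : ord0 \notin W ->
  rooted_graph (#|edges G| + n.+1) ord0 (contraction X W).
Proof.
move=> h0; apply: rel_graph_rooted; first exact: contracted_sym.
- by rewrite !inE eqxx.
- by move=> x; rewrite /contracted eqxx.
- apply: leq_trans (card_contraction X h0) _; rewrite leq_add2l.
  by rewrite -[X in _ <= X](card_ord n.+1) max_card.
Qed.

Lemma adj_induced S x y :
  adj (induced G S) x y = [&& adj G x y, x \in S & y \in S].
Proof.
rewrite /adj /= inE; congr (_ && _); apply/subsetP/andP => [h|[hx hy] z].
  by rewrite !h ?set21 ?set22.
by rewrite !inE => /orP[]/eqP->.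
Qed.

Lemma connect_map (T1 T2 : finType) (e1 : rel T1) (e2 : rel T2) (f : T1 -> T2) x y :
  (forall a b, e1 a b -> connect e2 (f a) (f b)) ->
  connect e1 x y -> connect e2 (f x) (f y).
Proof.
move=> h /connectP[p + ->]; elim: p x => [|z p IH] x /=; first by rewrite connect0.
by case/andP=> /h hxz /IH; apply: connect_trans.
Qed.

(** The number of components on the active set is the number of children of the root, plus one if
    vertex 0 is active but not contracted into anything. The bound 2 rather than equality to 1
    covers the empty active set. *)
Lemma connected_children S X T : pivot S X ->
  dfs_tree (contraction X (S :\ ord0)) ord0 T ->
  connected (induced G S) =
  (root_children (contraction X (S :\ ord0)) ord0 T +
    ((ord0 \in S) && (X == ord0)) < 2).
Proof.
move=> hp hT; set H := contraction X _ in hT *.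
have wfH : wf_graph H by apply: wf_rel_graph.
have vS : verts (induced G S) = S by rewrite /= vertsG setTI.
have conE : connected (induced G S) =
    [forall x in S, forall y in S, connect (adj (induced G S)) x y].
  by rewrite /connected vS.
rewrite {}conE; case: (boolP ((ord0 \in S) && _)) => [/andP[h0 /eqP X0]|h].
  (* Vertex 0 is active and isolated: the graph is connected exactly when it is the only active
     vertex, that is, when the root has no child. *)
  rewrite addn1 !ltnS leqn0 (root_children_eq0 wfH hT).
  move: hp; rewrite /pivot X0 eqxx h0 /= => /forall_inP iso.
  apply/forall_inP/eqP => [con|hV x hx].
    apply/setP=> y; rewrite !inE; case: eqP => //= /eqP y0.
    apply/negbTE/negP => hy; have /forall_inP/(_ _ hy) := con _ h0.
    case/connectP=> [[|z p] /= ]; first by move=> _ h; rewrite h eqxx in y0.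
    by rewrite adj_induced => /andP[/and3P[h _ /iso]]; rewrite h.
  have only z : z \in S -> z = ord0.
    move=> hz; apply/set1P; rewrite -hV !inE hz andbT; exact: orbN.
  by apply/forall_inP => y hy; rewrite (only x) // (only y) // connect0.
rewrite addn0 ltnS; set e := adj (induced G S).
have hX : ord0 \in S -> [/\ X != ord0, X \in S & adj G ord0 X].
  move=> h0; move: h; rewrite h0 /= => X0; move: hp.
  by rewrite /pivot (negbTE X0) => /and3P[].
(* The contraction map. It sends walks among active vertices to walks off the root, collapsing the
   edge between [ord0] and [X]. *)
pose f x := if x == ord0 then X else x.
have fW x : x \in S -> f x \in S :\ ord0.
  rewrite /f; case: eqP => [-> /hX[X0 XS _]|/eqP x0 hx]; rewrite !inE ?X0 ?x0 //.
have esym : connect_sym e.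
  by apply: sym_connect_sym => x y; rewrite /e !adj_induced adj_sym [_ && (x \in S)]andbC.
have oE a b : off_root H ord0 a b =
    [&& a \in S :\ ord0, b \in S :\ ord0, a != b & contracted X a b].
  rewrite /off_root adj_rel_graph; last exact: contracted_sym.
  by rewrite !inE; case: (a == ord0); case: (b == ord0); rewrite //= ?andbF.
apply/forall_inP/(root_children_le1 wfH hT) => [con x y|con x hx].
  rewrite !inE => /andP[x0 /(fun h => h)]; rewrite (negbTE x0) /= => hx.
  move=> /andP[y0]; rewrite (negbTE y0) /= => hy.
  have /forall_inP/(_ _ hy) := con _ hx.
  have -> : connect (off_root H ord0) x y = connect (off_root H ord0) (f x) (f y).
    by rewrite /f (negbTE x0) (negbTE y0).
  apply: connect_map => a b; rewrite /e adj_induced => /and3P[ab ha hb].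
  case: (eqVneq (f a) (f b)) => [->|fab]; first exact: connect0.
  apply: connect1; rewrite oE !fW // fab /= /contracted /f.
  move: fab; rewrite /f; case: (eqVneq a ord0) ab => [->|a0] ab.
    case: (eqVneq b ord0) ab => [->|b0] ab; first by rewrite adj_irr in ab.
    by rewrite eqxx ab !orbT.
  case: (eqVneq b ord0) ab => [->|b0] ab _; last by rewrite ab !orbT.
  by rewrite eqxx (adj_sym ord0 a) ab !orbT.
have tof z : z \in S -> connect e z (f z).
  rewrite /f; case: eqP => [-> h0|_ _]; last exact: connect0.
  have [_ XS hadj] := hX h0.
  by apply: connect1; rewrite /e adj_induced hadj h0 XS.
apply/forall_inP => y hy; apply: connect_trans (tof x hx) _.
rewrite esym; apply: connect_trans (tof y hy) _; rewrite esym.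
have fV z : z \in S -> f z \in verts H :\ ord0.
  by move=> /fW; rewrite !inE => /andP[-> ->]; rewrite orbT.
have := con _ _ (fV x hx) (fV y hy).
apply: (@connect_map _ _ _ _ id) => a b.
rewrite oE !inE => /and4P[/andP[a0 ha] /andP[b0 hb] ab].
have edge u v : u \in S -> v \in S -> adj G u v -> connect e u v.
  by move=> hu hv huv; apply: connect1; rewrite /e adj_induced huv hu.
(* Conversely, an edge created by contraction is replaced by the walk from [X] through [ord0]. *)
have in0 u : X != ord0 -> adj G ord0 u -> u \in S -> connect e X u.
  move=> X0; move: hp; rewrite /pivot (negbTE X0) => /and3P[h0 XS hadj] hu hu'.
  apply: connect_trans (edge ord0 u h0 hu' hu).
  by apply: edge => //; rewrite adj_sym.
rewrite /contracted (negbTE a0) (negbTE b0) /=.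
case/or3P=> [h1|/andP[/eqP aX h1]|/andP[/eqP bX h1]]; first exact: edge.
- by move: a0; rewrite aX => /in0; apply.
- by move: b0; rewrite esym bX => /in0; apply.
Qed.

Definition contraction_verts W : seq 'I_n.+1 :=
  ord0 :: [seq y <- enum 'I_n.+1 | y \in W].

(** Neighbours gained by [X] through contraction. Those already adjacent to [X] are left out because
    an encoding must not list an edge twice. *)
Definition fresh_neighbour X W y : bool :=
  [&& y \in W, X \in W, adj G ord0 y, y != X & ~~ adj G X y].

(** The order in which the three edge loops of [build] emit the edges; surviving edges keep their
    order and orientation from the input. *)
Definition contraction_edges es X W : seq ('I_n.+1 * 'I_n.+1) :=
  [seq e <- es | (e.1 \in W) && (e.2 \in W)] ++
  [seq (ord0, y) | y <- enum 'I_n.+1 & y \in W] ++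
  [seq (X, y) | y <- enum 'I_n.+1 & fresh_neighbour X W y].

Lemma lists_contraction_verts X W : ord0 \notin W ->
  lists (contraction_verts W) (verts (contraction X W)).
Proof.
move=> h0; split.
  by rewrite cons_uniq mem_filter (negbTE h0); apply/filter_uniq/enum_uniq.
by move=> y; rewrite !inE mem_filter mem_enum andbT.
Qed.

Lemma lists_contraction_edges es X W :
  ord0 \notin W -> (X != ord0 -> X \in W) -> lists_edges es (edges G) ->
  lists_edges (contraction_edges es X W) (edges (contraction X W)).
Proof.
move=> h0 hX [hu hm].
have W0 y : y \in W -> y != ord0 by apply: contraTneq => ->.
have adjE a b : ([set a; b] \in edges G) = adj G a b by [].
pose p2 (e : 'I_n.+1 * 'I_n.+1) := [set e.1; e.2].
have star_uniq (x : 'I_n.+1) (P : pred 'I_n.+1) :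
    uniq (map p2 [seq (x, y) | y <- enum 'I_n.+1 & P y]).
  rewrite -map_comp map_inj_uniq; first exact/filter_uniq/enum_uniq.
  by move=> y z; apply: set2_inj.
have mem1 e : e \in map p2 [seq e <- es | (e.1 \in W) && (e.2 \in W)] ->
    exists a b, [/\ e = [set a; b], a \in W, b \in W & adj G a b].
  case/mapP=> [[a b]]; rewrite mem_filter => /andP[/andP[ha hb] hab] ->.
  by exists a, b; split=> //; rewrite -adjE -hm; apply: (map_f p2 hab).
have memX (x : 'I_n.+1) (P : pred 'I_n.+1) e :
    reflect (exists2 y, P y & e = [set x; y])
      (e \in map p2 [seq (x, y) | y <- enum 'I_n.+1 & P y]).
  rewrite -map_comp; apply: (iffP mapP) => -[y hy ->]; exists y => //.
    by move: hy; rewrite mem_filter => /andP[].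
  by rewrite mem_filter hy mem_enum.
split; rewrite /contraction_edges !map_cat.
  rewrite !cat_uniq !star_uniq /= andbT; apply/and3P; split.
  - by apply: subseq_uniq hu; apply/map_subseq/filter_subseq.
  - apply/hasPn => e; rewrite mem_cat => he; apply/negP => /mem1[a [b [eab ha hb hab]]].
    case/orP: he => /memX[y hy e2].
      have : ord0 \in e by rewrite e2 set21.
      by rewrite eab !inE => /orP[]/eqP hz; rewrite hz ?ha ?hb in h0.
    case/and5P: hy => _ _ _ _ /negP; apply.
    by rewrite -adjE -e2 eab adjE.
  - apply/hasPn => e /memX[y /and5P[hy hXW _ _ _] ->]; apply/negP => /memX[z hz].
    case/set2_eq => [[X0 _]|[_ y0]]; first by rewrite X0 (negbTE h0) in hXW.
    by rewrite y0 (negbTE h0) in hy.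
move=> e; rewrite !mem_cat; apply/or3P/rel_graph_edgeP => [[]|].
- case/mem1=> a [b [-> ha hb hab]]; exists a, b; split=> //.
  + by rewrite inE ha orbT.
  + by rewrite inE hb orbT.
  + by apply: contraTneq hab => ->; rewrite adj_irr.
  + by rewrite /contracted hab !orbT.
- case/memX=> y hy ->; exists ord0, y; split; rewrite ?inE ?eqxx ?hy ?orbT //.
  by rewrite eq_sym W0.
- case/memX=> y /and5P[hy hXW h0y hyX _] ->; exists X, y.
  split; rewrite ?inE ?hXW ?hy ?orbT //; first by rewrite eq_sym.
  by rewrite /contracted eqxx h0y !orbT.
have old a b : a \in W -> b \in W -> adj G a b ->
    [set a; b] \in map p2 [seq e <- es | (e.1 \in W) && (e.2 \in W)].
  move=> ha hb; rewrite -adjE -hm => /mapP[[c d] hcd] /= hE.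
  rewrite hE; apply/mapP; exists (c, d) => //; rewrite mem_filter hcd andbT /=.
  by case/set2_eq: hE => [[<- <-]|[<- <-]]; rewrite ha hb.
have fresh b : X \in W -> b \in W -> b != X -> adj G ord0 b ->
    [\/ [set X; b] \in map p2 [seq e <- es | (e.1 \in W) && (e.2 \in W)],
      [set X; b] \in map p2 [seq (ord0, y) | y <- enum 'I_n.+1 & y \in W]
    | [set X; b] \in map p2 [seq (X, y) | y <- enum 'I_n.+1 & fresh_neighbour X W y]].
  move=> hXW hb bX h0b; case: (boolP (adj G X b)) => [/old|nXb].
    by move=> h; apply: Or31; apply: h.
  apply: Or33; apply/memX; exists b => //.
  by rewrite /fresh_neighbour hb hXW h0b bX.
case=> a [b [-> ]]; rewrite !inE => /orP[/eqP->|ha] /orP[/eqP->|hb] ab.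
- by rewrite eqxx in ab.
- by move=> _; apply: Or32; apply/memX; exists b.
- by move=> _; apply: Or32; apply/memX; exists a; rewrite // setUC.
- rewrite /contracted (negbTE (W0 _ ha)) (negbTE (W0 _ hb)) /=.
  case/or3P=> [hab|/andP[/eqP aX h0b]|/andP[/eqP bX h0a]].
  + by apply: Or31; apply: old.
  + by rewrite aX; apply: fresh; rewrite // -?aX // eq_sym.
  + by rewrite bX setUC; apply: fresh; rewrite // -?bX.
Qed.


Lemma exists_lists_edges (H : graph n.+1) : wf_graph H ->
  exists es, lists_edges es (edges H).
Proof.
move=> wfH; have [|es hes] := @orient_edges _ (enum (edges H)).
  by move=> e; rewrite mem_enum => /wfH[].
by exists es; rewrite /lists_edges hes; split=> [|x]; rewrite ?enum_uniq ?mem_enum.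
Qed.

Lemma size_lists_edges es (H : graph n.+1) :
  lists_edges es (edges H) -> size es = #|edges H|.
Proof.
by case=> hu hm; rewrite -(size_map (fun e => [set e.1; e.2])) -(card_uniqP hu); apply: eq_card.
Qed.

Lemma size_code_edges (es : seq ('I_n.+1 * 'I_n.+1)) :
  size (code_edges es) = 2 * size es.
Proof. by elim: es => //= e es; rewrite mulnS /code_edges /= => ->. Qed.

(** A witness that makes [p] at least linear: the contraction without pivot on all vertices contains
    every edge of [G], so its encoding is at least as long as that of [G] up to constants. *)
Lemma exists_large_graph : exists H vs es,
  [/\ rooted_graph (#|edges G| + n.+1) (ord0 : 'I_n.+1) H, lists vs (verts H),
      lists_edges es (edges H) &
      forall m, n.+1 + 2 * #|edges G| <= size (code_graph m (ord0 : 'I_n.+1) vs es)].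
Proof.
pose W := [set~ (ord0 : 'I_n.+1)]; have h0 : (ord0 : 'I_n.+1) \notin W by rewrite !inE eqxx.
pose H := contraction ord0 W; have [es hes] := exists_lists_edges (@wf_rel_graph _ _ _ : wf_graph H).
exists H, (enum (verts H)), es; split=> //.
- exact: contraction_rooted.
- by split=> [|x]; rewrite ?enum_uniq ?mem_enum.
move=> m; rewrite /code_graph /= !size_cat size_code_edges size_map -cardE.
rewrite (size_lists_edges hes).
have -> : ord0 |: W = [set: 'I_n.+1] by apply/setP=> x; rewrite !inE; case: eqP.
rewrite cardsT card_ord.
suff h : #|edges G| <= #|edges H|.
  by do 5!apply: leqW; rewrite leq_add2l leq_mul2l h.
apply/subset_leq_card/subsetP=> e he; have [/eqP/cards2P[a [b [ab eab]]] _] := wfG he.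
apply/rel_graph_edgeP; exists a, b; split=> //; try by rewrite !inE; case: eqP.
by rewrite /contracted /adj -eab he !orbT.
Qed.

End Contraction.

(** A witness that makes [u] at least linear. Only half of the vertices are used, because the star
    that keeps [H] connected and the edges of the inserted vertex must together fit into [n.+1]
    edges. *)
Lemma exists_large_insertion n m : 0 < n -> n.+1 <= m -> exists H v N,
  [/\ rooted_graph m ord0 H, update_ok H ord0 (Insert v N),
      rooted_graph m ord0 (apply_update H (Insert v N)) &
      size (N : seq 'I_n.+1) = n.+1./2].
Proof.
move=> n0 hm; set h := n.+1./2.
have lh : h < n.+1 by rewrite /h; lia.
have h0 : 0 < h by rewrite /h; lia.
pose V := [set widen_ord (ltnW lh) x | x : 'I_h]; pose v := Ordinal lh.
have cV : #|V| = h.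
  by rewrite card_imset ?card_ord // => x y /(congr1 val) /= /val_inj.
have vV : v \notin V.
  by apply/imsetP => -[x _ /(congr1 val) /= hx]; have := ltn_ord x; rewrite -hx ltnn.
have rV : ord0 \in V by apply/imsetP; exists (Ordinal h0) => //; apply: val_inj.
pose E1 : rel 'I_n.+1 := fun a b => (a == ord0) || (b == ord0).
pose E2 : rel 'I_n.+1 := fun a b => [|| a == ord0, b == ord0, a == v | b == v].
have E2sym : symmetric E2.
  by move=> a b; rewrite /E2 orbCA; do 2!congr (_ || _); apply: orbC.
(* As [v] is outside [V], one relation [E2] describes the graph both before and after the
   insertion. *)
have E12 : rel_graph V E1 = rel_graph V E2.
  apply: rel_graph_eq => a b ha hb; rewrite /E1 /E2.
  have ne x : x \in V -> (x == v) = false.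
    by move=> hx; apply/negbTE; apply: contraNneq vV => <-.
  by rewrite !ne // !orbF.
have Ve : #|edges (rel_graph V E1)| <= h.
  rewrite -cV; apply: leq_trans (leq_imset_card (fun y => [set ord0; y]) _).
  apply/subset_leq_card/subsetP => e /rel_graph_edgeP[a [b [-> ha hb _]]].
  case/orP=> /eqP->; first exact: imset_f.
  by rewrite setUC; apply: imset_f.
have insE : apply_update (rel_graph V E1) (Insert v (enum V)) = rel_graph (v |: V) E2.
  rewrite E12; apply: rel_graph_insert => // x.
  by rewrite mem_enum /E2 eqxx !orbT andbT.
exists (rel_graph V E1), v, (enum V); split.
- rewrite E12; apply: rel_graph_rooted => //.
  + by rewrite -E12; apply: leq_trans Ve _; lia.
- by split; rewrite ?enum_uniq // => x; rewrite mem_enum.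
- have : #|edges (apply_update (rel_graph V E1) (Insert v (enum V)))| <= h + h.
    apply: leq_trans (leq_card_setU _ _) (leq_add Ve _).
    by apply: leq_trans (leq_imset_card _ _) _; rewrite -cV [X in _ <= X]cardE; apply: card_size.
  rewrite insE => hc; apply: rel_graph_rooted => //; first by rewrite !inE rV orbT.
  by apply: leq_trans hc _; rewrite /h; lia.
- by rewrite -cardE.
Qed.

(** * The reduction *)

Notation vN := 1.
Notation vX := 2.
Notation vY := 3.
Notation vI := 4.
Notation vOld := 5.
Notation vV := 6.
Notation vNew := 7.
Notation vM := 8.
Notation vK := 9.
Notation vLen := 10.
Notation vEnd := 11.
Notation aAdj := 1.
Notation aAct := 2.
Notation aIn := 3.  (* the non-root vertices of the simulated graph *)

Definition entry (a : nat) (x y : expr) : expr :=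
  Arr a (Op OAdd (Op OMul x (Var vN)) y).

(** Products of bits serve as conjunctions. The initial 0 means that no pivot was found; it cannot
    be confused with a hit, since [G] has no loop at vertex 0. *)
Definition find_pivot : cmd :=
  Seq (asg vNew (Num 0))
    (for_ vI vN
      (ife (Op OMul (Op OMul (Arr aAct (Var vI)) (Arr aAct (Num 0)))
             (Arr aAdj (Var vI)))
        (asg vNew (Var vI)) Skip)).

(** The membership test makes repeated calls harmless, so the old pivot, the toggled vertex and the
    new pivot may coincide or be vertex 0, which is never recorded in [aIn]. *)
Definition detach (c : cmd) : cmd :=
  ife (Arr aIn (Var vY))
    (Seq open_call (Seq (push (Num 0)) (Seq (push (Var vY))
      (Seq (shift c) (put aIn (Var vY) (Num 0)))))) Skip.

(** The sum acts as a disjunction, as only being nonzero matters. The clauses of [contracted] about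
    [ord0] are absent because [attach] pushes the root separately as first neighbour. *)
Definition attach_cond : expr :=
  (Op OMul (Arr aIn (Var vI))
          (Op OAdd (entry aAdj (Var vY) (Var vI))
            (Op OAdd
              (Op OMul (Op OEq (Var vY) (Var vX)) (Arr aAdj (Var vI)))
              (Op OMul (Op OEq (Var vI) (Var vX)) (Arr aAdj (Var vY)))))).

Definition attach (c : cmd) : cmd :=
  ife (Op OMul (Op OMul (Arr aAct (Var vY)) (Op OEq (Arr aIn (Var vY)) (Num 0)))
        (Op OLt (Num 0) (Var vY)))
    (Seq open_call (Seq (push (Num 1)) (Seq (push (Var vY))
      (Seq (push (Num 0)) (Seq (push (Num 0))
      (Seq (emit vI vN attach_cond [:: Var vI])
      (Seq (get_length vLen) (Seq (poke 2 (Op OSub (Var vLen) (Num 3)))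
      (Seq (shift c) (put aIn (Var vY) (Num 1))))))))))) Skip.

(** [vX] is changed only when the old and the new pivot are both detached, since the change then
    does not affect the simulated graph. The new pivot can be searched for only after the activity
    bit has been flipped. *)
Definition toggle_vertex (c : cmd) : cmd :=
  Seq (asg vV (Arr 0 (Num 0))) (Seq (asg vOld (Var vX))
    (Seq (asg vY (Var vOld)) (Seq (detach c)
    (Seq (asg vY (Var vV)) (Seq (detach c)
    (Seq (put aAct (Var vV) (Op OSub (Num 1) (Arr aAct (Var vV))))
    (Seq find_pivot
    (Seq (asg vY (Var vNew)) (Seq (detach c)
    (Seq (asg vX (Var vNew))
    (Seq (asg vY (Var vOld)) (Seq (attach c)
    (Seq (asg vY (Var vV)) (Seq (attach c)
    (Seq (asg vY (Var vNew)) (attach c)))))))))))))))).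

(** Without vertices there is no root and no simulated algorithm; the answer is 1 because the empty
    graph counts as connected. *)
Definition answer_query (c : cmd) : cmd :=
  ife (Var vN)
    (Seq open_call (Seq (shift c) (Seq (get_length vLen)
      (asg 0 (Op OLt
        (Op OAdd (Var vLen) (Op OMul (Arr aAct (Num 0)) (Op OEq (Var vX) (Num 0))))
        (Num 2))))))
    (asg 0 (Num 1)).

(** In the input, edges follow three header words and the [vK] active vertices. *)
Definition edge_end (x : expr) : expr :=
  Arr 0 (Op OAdd (Op OAdd (Num 3) (Var vK)) x).
Definition edge_src : expr := edge_end (Op OMul (Num 2) (Var vI)).
Definition edge_dst : expr :=
  edge_end (Op OAdd (Op OMul (Num 2) (Var vI)) (Num 1)).

Definition load_active : cmd :=
  for_ vI vK (put aAct (Arr 0 (Op OAdd (Num 3) (Var vI))) (Num 1)).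

Definition load_edges : cmd :=
  for_ vI vM
    (Seq
      (put aAdj (Op OAdd (Op OMul edge_src (Var vN)) edge_dst) (Num 1))
      (put aAdj (Op OAdd (Op OMul edge_dst (Var vN)) edge_src) (Num 1))).

Definition load_contents : cmd :=
  for_ vI vN
    (put aIn (Var vI) (Op OMul (Arr aAct (Var vI)) (Op OLt (Num 0) (Var vI)))).

Definition load : cmd := Seq load_active (Seq load_edges load_contents).

Definition fresh_cond : expr :=
  Op OMul (Op OMul (Arr aIn (Var vI)) (Arr aIn (Var vX)))
    (Op OMul (Arr aAdj (Var vI))
      (Op OMul (Op OEq (Op OEq (Var vI) (Var vX)) (Num 0))
        (Op OEq (entry aAdj (Var vX) (Var vI)) (Num 0)))).

(** The four zeros are the root, placeholders for the numbers of vertices and edges, and the root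
    again as first listed vertex. The second header word announces m + n as edge bound. *)
Definition build (c : cmd) : cmd :=
  Seq open_call (Seq
    (pushes [:: Var vN; Op OAdd (Var vM) (Var vN); Num 0; Num 0; Num 0; Num 0])
    (Seq (emit vI vN (Arr aIn (Var vI)) [:: Var vI])
    (Seq (get_length vLen) (Seq (poke 3 (Op OSub (Var vLen) (Num 5)))
    (Seq (emit vI vM (Op OMul (Arr aIn edge_src) (Arr aIn edge_dst))
           [:: edge_src; edge_dst])
    (Seq (emit vI vN (Arr aIn (Var vI)) [:: Num 0; Var vI])
    (Seq (emit vI vN fresh_cond [:: Var vX; Var vI])
    (Seq (get_length vEnd)
    (Seq (poke 4 (Op ODiv (Op OSub (Var vEnd) (Var vLen)) (Num 2)))
    (shift c)))))))))).

Definition initialize (c : cmd) : cmd :=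
  Seq (asg vN (Arr 0 (Num 0))) (Seq (asg vM (Arr 0 (Num 1)))
    (Seq (asg vK (Arr 0 (Num 2)))
      (ife (Var vN)
        (Seq load (Seq find_pivot (Seq (asg vX (Var vNew)) (build c)))) Skip))).

Fixpoint last_below (p : pred nat) (k : nat) : nat :=
  if k is k'.+1 then if p k' then k' else last_below p k' else 0.

(** Describes a loop in which later hits overwrite earlier ones. Index 0 is excluded from both cases
    because a hit there looks like the default. *)
Lemma last_belowP p k :
  (last_below p k = 0 /\ forall i, 0 < i < k -> ~~ p i) \/
  [/\ 0 < last_below p k, last_below p k < k & p (last_below p k)].
Proof.
elim: k => [|k IH] /=; first by left; split=> // i; rewrite ltn0 andbF.
case: ifP => pk; last first.
  case: IH => [[-> h]|[h1 h2 h3]]; last by right; split=> //; apply: ltnW.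
  left; split=> // i /andP[i0]; rewrite ltnS leq_eqVlt => /orP[/eqP->|ik].
    by rewrite pk.
  by apply: h; rewrite i0.
by case: k pk {IH} => [|k] pk; [left; split=> // -[] | right].
Qed.

Lemma flatten_if (T U : Type) (p : pred T) (g : T -> U) (s : seq T) :
  flatten [seq if p x then [:: g x] else [::] | x <- s] = [seq g x | x <- s & p x].
Proof. by elim: s => //= x s ->; case: (p x). Qed.

Lemma flatten_if_seq (T U : Type) (p : pred T) (g : T -> seq U) (s : seq T) :
  flatten [seq if p x then g x else [::] | x <- s] = flatten [seq g x | x <- s & p x].
Proof. by elim: s => //= x s ->; case: (p x). Qed.

Lemma onth_enum_ord m k (x : 'I_m) : onth (enum 'I_m) k = Some x -> k = x.
Proof.
move=> h; have hk : k < m by rewrite -[m]size_enum_ord -onthTE h.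
by rewrite -(onth_nth x _ _ _ h) nth_enum_ord.
Qed.

(** * Word sizes and the search for a pivot *)

Section Simulation.

Variables (n : nat) (G : graph n.+1) (w : nat).
Hypotheses (wfG : wf_graph G) (vertsG : verts G = [set: 'I_n.+1]).
(** The square covers indices into the adjacency matrix, the linear term all counters and the
    lengths of the inputs that are read or assembled. *)
Hypothesis (word_size : n.+1 * n.+1 + 8 * (#|edges G| + n.+3) < 2 ^ w).
Implicit Types (S W : {set 'I_n.+1}) (X y : 'I_n.+1) (M : mem).

Lemma index_lt (i j : 'I_n.+1) : i * n.+1 + j < n.+1 * n.+1.
Proof. by have := ltn_ord i; have := ltn_ord j; nia. Qed.

Lemma small_lt k : k <= 8 * (#|edges G| + n.+3) -> k < 2 ^ w.
Proof. by move=> hk; move: word_size; lia. Qed.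

Lemma tiny_lt k : k <= 8 -> k < 2 ^ w.
Proof. by move=> hk; apply: small_lt; lia. Qed.

Lemma ord_lt (i : 'I_n.+1) : i < 2 ^ w.
Proof. by have := ltn_ord i; move=> ?; apply: small_lt; lia. Qed.

Lemma bool_lt (b : bool) : b < 2 ^ w.
Proof. by apply: small_lt; case: b; lia. Qed.

Lemma order_lt : n.+1 < 2 ^ w.
Proof. by apply: small_lt; lia. Qed.

Lemma entry_lt (i j : 'I_n.+1) : i * n.+1 + j < 2 ^ w.
Proof. by apply: leq_trans (index_lt i j) _; move: word_size; lia. Qed.

Lemma row_lt (i : 'I_n.+1) : i * n.+1 < 2 ^ w.
Proof. by rewrite -[i * _]addn0; apply: (entry_lt i ord0). Qed.

(** The active set [S] and the contents [W] of the simulated graph are separate because they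
    disagree in the middle of a toggle. *)
Definition stores S W M : Prop :=
  [/\ rg M vN = n.+1,
      forall i j : 'I_n.+1, ar M aAdj (i * n.+1 + j) = adj G i j,
      forall i : 'I_n.+1, ar M aAct i = (i \in S) &
      forall i : 'I_n.+1, ar M aIn i = (i \in W)].

Lemma stores_row0 S W M i : stores S W M -> ar M aAdj (i : 'I_n.+1) = adj G ord0 i.
Proof. by case=> _ <- _ _. Qed.

Lemma run_find_pivot S W M (Q : nat -> mem -> Prop) : stores S W M ->
  (forall X, pivot G S X ->
     Q (8 + n.+1 * 28) (setr (setr M vNew X) vI n.+1)) ->
  run w find_pivot M Q.
Proof.
move=> hM hQ; have [hN _ hact _] := hM.
pose p k := ar M aAct k * ar M aAct 0 * ar M aAdj k != 0.
have pE (i : 'I_n.+1) : p i = [&& i \in S, ord0 \in S & adj G ord0 i].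
  have := hact ord0; rewrite /p /= hact (stores_row0 _ hM) => ->.
  by case: (i \in S); case: (ord0 \in S); case: adj.
pose F k := setr (setr M vNew (last_below p k)) vI k.
apply: run_seq; apply: run_asg => //=; try exact: small_lt.
apply: (@run_for _ _ _ _ 20 F n.+1) => //.
- by apply: small_lt; lia.
- move=> k hk; set i := Ordinal hk.
  have fI : k < 2 ^ w by exact: (ord_lt i).
  have h0 := hact ord0; rewrite /= in h0.
  have valE : ar M aAct k * ar M aAct 0 * ar M aAdj k =
      [&& i \in S, ord0 \in S & adj G ord0 i].
    rewrite (hact i) h0 (stores_row0 i hM).
    by case: (i \in S); case: (ord0 \in S); case: adj.
  apply: run_ife => //=.
  + rewrite fI (hact i) h0 -mulnA mulnA -h0 -(hact i) valE bool_lt small_lt //=.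
    by rewrite (hact i) h0 mulnb bool_lt.
  + move=> hp; apply: run_asg => //=; split=> //.
    by split=> // z /=; case: eqP => // _; case: eqP => // _; rewrite /p ifT //; exact/eqP.
  + move=> hp; apply: run_skip; split=> //.
    by split=> // z /=; case: eqP => // _; case: eqP => // _; rewrite /p hp.
have lp := last_belowP p n.+1.
have X_lt : last_below p n.+1 < n.+1 by case: lp => [[->]|[]].
have -> : F n.+1 = setr (setr M vNew (Ordinal X_lt)) vI n.+1 by [].
have hX : pivot G S (Ordinal X_lt).
  have XE : (Ordinal X_lt == ord0) = (last_below p n.+1 == 0) by [].
  rewrite /pivot; case: lp => [[lp0 lp]|[lp0 _ lp]].
    rewrite (_ : _ == ord0); last by rewrite XE lp0.
    apply/implyP => h0; apply/forall_inP => y hy; apply/negP => hadj.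
    case: (eqVneq y ord0) hadj => [->|y0 hadj]; first by rewrite adj_irr.
    have := lp y; rewrite ltn_ord andbT lt0n => /(_ y0).
    by rewrite pE hy h0 hadj.
  rewrite (_ : _ == ord0 = false); last by rewrite XE eqn0Ngt lp0.
  by rewrite andbCA -(pE (Ordinal X_lt)).
exact: hQ hX.
Qed.

(** * Updates and queries *)

Section Updates.

Variables (rep : graph n.+1 -> ('I_n.+1 -> 'I_n.+1) -> state -> Prop).
Variables (c : cmd) (b : nat).
Hypothesis update_call : forall H T s o, rep H T s ->
  update_ok H ord0 o ->
  rooted_graph (#|edges G| + n.+1) ord0 (apply_update H o) ->
  call w c (code_update o) s b
    (fun s' => exists T', rep (apply_update H o) T' s').

Definition holds S X W M : Prop :=
  [/\ stores S W M, rg M vX = X & exists T, rep (contraction G X W) T (sub M)].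

Definition same_vars M M' : Prop :=
  forall x, x != vI -> x != vLen -> rg M' x = rg M x.

Lemma detach_call X W y T s :
  ord0 \notin W -> y \in W -> rep (contraction G X W) T s ->
  call w c [:: 0; val y] s b
    (fun s' => exists T', rep (contraction G X (W :\ y)) T' s').
Proof.
move=> W0 yW hT; have y0 : y != ord0 by apply: contraTneq yW => ->.
have <- : apply_update (contraction G X W) (Delete y) = contraction G X (W :\ y).
  rewrite rel_graph_delete; congr rel_graph; apply/setP=> z; rewrite !inE.
  by case: (eqVneq z ord0) => // ->; rewrite eq_sym y0.
apply: (update_call (o := Delete y) hT); first by rewrite /= !inE yW orbT.
rewrite rel_graph_delete (_ : _ :\ y = ord0 |: (W :\ y)).
  by apply: contraction_rooted; rewrite // !inE negb_and W0 orbT.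
apply/setP=> z; rewrite !inE.
by case: (eqVneq z ord0) => // ->; rewrite eq_sym y0.
Qed.

Lemma run_detach S X W M y (Q : nat -> mem -> Prop) :
  holds S X W M -> ord0 \notin W -> rg M vY = y ->
  (forall M' k, k <= b + 30 -> holds S X (W :\ y) M' -> same_vars M M' -> Q k M') ->
  run w (detach c) M Q.
Proof.
move=> [[hN hadj hact hin] hX [T hT]] W0 hy hQ.
have yw := ord_lt y.
apply: run_ife => //=; first by rewrite hy.
  rewrite hy hin => /eqP; rewrite eqb0 negbK => yW.
  apply: run_seq; apply: run_open_call; apply: run_seq.
  apply: (@run_push _ _ [::] (sub M)) => //=; rewrite ?tiny_lt //.
  apply: run_seq; apply: (@run_push _ _ [:: 0] (sub M)) => //=; rewrite ?hy //.
    by apply: small_lt; lia.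
  apply: run_seq.
  apply: (run_shift _ (detach_call W0 yW hT)) => //= a' ha'.
  apply: run_put => //=; rewrite ?hy ?yw ?tiny_lt //.
  apply: hQ => //; first lia.
  split=> //=; split=> //= z; rewrite !inE; case: (eqVneq z y) => [->|zy] /=.
    by rewrite eqxx.
  by rewrite hin; case: eqP => // /val_inj zy'; rewrite zy' eqxx in zy.
rewrite hy hin => /eqP; rewrite eqb0 => yW.
apply: run_skip; apply: hQ => //=; first lia.
have -> : W :\ y = W.
  by apply/setP=> z; rewrite !inE; case: eqP => // ->; rewrite (negbTE yW).
by split=> //; exists T.
Qed.

Definition attach_list X W y : seq 'I_n.+1 :=
  ord0 :: [seq x <- enum 'I_n.+1 | (x \in W) && contracted G X y x].

Lemma attach_call X W y T s :
  ord0 \notin W -> y \notin W -> y != ord0 -> rep (contraction G X W) T s ->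
  call w c ([:: 1; val y; size (attach_list X W y)] ++ map val (attach_list X W y)) s b
    (fun s' => exists T', rep (contraction G X (y |: W)) T' s').
Proof.
move=> W0 yW y0 hT; set N := attach_list X W y.
have insE : apply_update (contraction G X W) (Insert y N) = contraction G X (y |: W).
  rewrite rel_graph_insert; first by rewrite setUCA.
  - exact: contracted_sym.
  - by rewrite !inE negb_or y0.
  - move=> x; rewrite !inE mem_filter mem_enum andbT.
    by case: eqP => [->|] //=; rewrite /contracted eqxx orbT.
rewrite -insE; apply: (update_call (o := Insert y N) hT).
  split; first by rewrite !inE negb_or y0.
  - by rewrite cons_uniq mem_filter (negbTE W0); apply/filter_uniq/enum_uniq.
  - by move=> x; rewrite !inE mem_filter => /orP[->//|/andP[/andP[->]]]; rewrite orbT.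
rewrite insE; apply: contraction_rooted => //.
by rewrite !inE negb_or eq_sym y0.
Qed.

Lemma run_attach S X W M y (Q : nat -> mem -> Prop) :
  holds S X W M -> ord0 \notin W -> rg M vY = y ->
  (forall M' k, k <= b + 60 + n.+1 * 40 ->
     holds S X (if (y != ord0) && (y \in S) then y |: W else W) M' ->
     same_vars M M' -> Q k M') ->
  run w (attach c) M Q.
Proof.
move=> [hst hX [T hT]] W0 hy hQ; have [hN hadj hact hin] := hst.
have yw := ord_lt y.
have bool2_lt (b1 b2 : bool) : b1 + b2 < 2 ^ w.
  by apply: tiny_lt; case: b1 b2 => [] [].
have bool3_lt (b1 b2 b3 : bool) : b1 + (b2 + b3) < 2 ^ w.
  by apply: tiny_lt; case: b1 b2 b3 => [] [] [].
have bool4_lt (b1 b2 b3 b4 : bool) : b1 * (b2 + (b3 + b4)) < 2 ^ w.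
  by apply: tiny_lt; case: b1 b2 b3 b4 => [] [] [] [].
have hw : n.+1 + 8 < 2 ^ w by apply: small_lt; lia.
have testE : ar M aAct (rg M vY) * (ar M aIn (rg M vY) == 0) * (0 < rg M vY) =
    [&& y \in S, y \notin W & y != ord0].
  rewrite hy hact hin eqb0 -[0 < y]/(0 < val y) lt0n.
  by rewrite (_ : (val y != 0) = (y != ord0)) // !mulnb andbA.
apply: run_ife => //=.
- by rewrite testE bool_lt hy hact hin eqb0 mulnb !bool_lt ?ord_lt tiny_lt.
- rewrite testE => /eqP; rewrite eqb0 negbK => /and3P[yS yW y0].
  apply: run_seq; apply: run_open_call.
  apply: run_seq; apply: (@run_push _ _ [::] (sub M)) => //=; rewrite ?tiny_lt //.
  apply: run_seq; apply: (@run_push _ _ [:: 1] (sub M)) => //=; rewrite ?hy ?yw ?tiny_lt //.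
  apply: run_seq; apply: (@run_push _ _ [:: 1; val y] (sub M)) => //=; rewrite ?tiny_lt //.
  apply: run_seq; apply: (@run_push _ _ [:: 1; val y; 0] (sub M)) => //=; rewrite ?tiny_lt //.
  set N := attach_list X W y.
  set f := fun x : 'I_n.+1 => if (x \in W) && contracted G X y x then [:: val x] else [::].
  have fE : flatten (map f (enum 'I_n.+1)) = behead (map val N) by rewrite flatten_if.
  have szN : size N <= n.+2.
    by rewrite /= ltnS -[X in _ <= X](size_enum_ord n.+1) size_filter count_size.
  have szB : size (behead (map val N)) <= n.+1.
    by rewrite size_behead size_map; case: (size N) szN.
  apply: run_seq.
  apply: (@run_emit _ (enum 'I_n.+1) f _ _ _ _ _ [:: 1; val y; 0; 0] (sub M)) => //.
  + by rewrite size_enum_ord /= hN.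
  + by rewrite size_enum_ord; apply: small_lt; lia.
  + rewrite fE size_cat; apply: leq_ltn_trans (leq_add (leqnn 4) szB) _; lia.
  + move=> k x /onth_enum_ord->; set M1 := setr _ _ _.
    have valE : eval M1 attach_cond =
        (x \in W) * (adj G y x + ((y == X) * adj G ord0 x + (x == X) * adj G ord0 y)).
      by rewrite /M1 /= hy hN hX hin hadj !(stores_row0 _ hst).
    have condE : (eval M1 attach_cond != 0) = (x \in W) && contracted G X y x.
      rewrite valE /contracted (negbTE y0) /=.
      case xW: (x \in W) => //=; have x0 : x != ord0 by apply: contraTneq xW => ->.
      rewrite (negbTE x0) mul1n.
      by case: (adj G y x) (y == X) (adj G ord0 x) (x == X) (adj G ord0 y)
        => [] [] [] [] [].
    rewrite condE /f; split; last by case: ifP.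
    * rewrite /attach_cond /= hy hN hX hin hadj !(stores_row0 _ hst) !ord_lt /=.
      by rewrite order_lt row_lt entry_lt !mulnb !bool_lt bool2_lt bool3_lt bool4_lt.
    * by rewrite /M1 /= ord_lt.
  rewrite fE size_enum_ord.
  set B := behead _ in szB *; set xs := _ ++ B.
  (* Of the four words pushed before the loop only three are header; the fourth is the root, the
     first entry of [N]. *)
  have lenE : size xs = (size N + 3)%N by rewrite size_cat size_behead size_map /= addn3.
  have lenw : size xs < 2 ^ w by move: szB hw; rewrite size_cat /=; lia.
  apply: run_seq; apply: run_get_length => //=.
  have fit : [&& size xs < 2 ^ w, 3 < 2 ^ w & size xs - 3 < 2 ^ w].
    by rewrite lenw tiny_lt // (leq_ltn_trans (leq_subr _ _) lenw).
  apply: run_seq; apply: (@run_poke _ _ _ xs (sub M)) => //; first exact: tiny_lt.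
  rewrite (_ : eval _ _ = size N); last by rewrite -(addnK 3 (size N)) -lenE.
  apply: run_seq; apply: (run_shift _ (attach_call W0 yW y0 hT)) => // a' ha'.
  apply: run_put => //=; rewrite ?hy ?yw ?tiny_lt //.
  apply: hQ.
  + by clear; lia.
  + rewrite y0 yS; split=> //=; split=> //= z; rewrite !inE.
    case: (eqVneq z y) => [->|zy] /=; first by rewrite eqxx.
    by rewrite hin; case: eqP => // /val_inj zy'; rewrite zy' eqxx in zy.
  + by move=> z /= /negbTE-> /negbTE->.
rewrite testE => /eqP; rewrite eqb0 => hc.
apply: run_skip; apply: hQ => //=; first lia.
have -> : (if (y != ord0) && (y \in S) then y |: W else W) = W.
  case: ifP => // /andP[y0 yS]; apply/setP=> z; rewrite !inE; case: eqP => //= ->.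
  by move: hc; rewrite y0 yS andbT /= negbK.
by split=> //; exists T.
Qed.

Lemma in_toggle S y z : (z \in toggle S y) = (if z == y then z \notin S else z \in S).
Proof.
rewrite /toggle; case: ifPn => hy; rewrite !inE; case: eqVneq => // ->.
  by rewrite hy.
by rewrite hy.
Qed.

(** A pivot outside the graph contributes no edge to it. This lets a toggle switch pivots without a
    call to the simulated algorithm. *)
Lemma contraction_change X X' W : X \notin W -> X' \notin W ->
  contraction G X W = contraction G X' W.
Proof.
move=> hX hX'; apply: rel_graph_eq => u v; rewrite !inE.
have ne z Y : Y \notin W -> z \in W -> (z == Y) = false.
  by move=> hY hz; apply/negbTE; apply: contraNneq hY => <-.
rewrite /contracted; case: eqP => //= _ hu; case: eqP => //= _ hv.
by rewrite !ne.
Qed.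

Lemma holds_setr S X W M x v : x != vN -> x != vX ->
  holds S X W M -> holds S X W (setr M x v).
Proof.
move=> nN nX [[hN hadj hact hin] hX hT]; split=> //=; last by rewrite eq_sym (negbTE nX).
by split=> //=; rewrite eq_sym (negbTE nN).
Qed.

Lemma run_copy x z M (i : 'I_n.+1) (Q : nat -> mem -> Prop) :
  x < tmp_reg -> z < tmp_reg -> rg M z = i -> Q 2 (setr M x i) ->
  run w (asg x (Var z)) M Q.
Proof.
move=> lx lz hz hq; have hi := ord_lt i.
by apply: run_asg => //=; rewrite ?hz // /legal /= lz.
Qed.

Definition represents S M : Prop :=
  exists2 X, pivot G S X & holds S X (S :\ ord0) M.

Lemma run_toggle_vertex S M v (Q : nat -> mem -> Prop) :
  represents S M -> ar M 0 0 = (v : 'I_n.+1) ->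
  (forall M' k, k <= 6 * b + 400 + n.+1 * 200 ->
     represents (toggle S v) M' -> Q k M') ->
  run w (toggle_vertex c) M Q.
Proof.
move=> [X _ hM] hv hQ; have hX : rg M vX = X by case: hM.
have vw := ord_lt v.
apply: run_seq; apply: run_asg => //=; rewrite ?hv //; first by apply: small_lt; lia.
apply: run_seq; apply: (@run_copy _ _ _ X) => //.
apply: run_seq; apply: (@run_copy _ _ _ X) => //.
set M1 := setr _ _ _.
have hM1 : holds S X (S :\ ord0) M1 by do 3!apply: holds_setr => //.
apply: run_seq; apply: (run_detach hM1) => //; first by rewrite !inE eqxx.
move=> M2 k2 lk2; set W2 := _ :\ X => hM2 sv2.
apply: run_seq; apply: (@run_copy _ _ _ v) => //; first by rewrite sv2.
have {}hM2 : holds S X W2 (setr M2 vY v) by apply: holds_setr.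
apply: run_seq; apply: (run_detach hM2) => //; first by rewrite !inE eqxx !andbF.
move=> M3 k3 lk3; set W3 := _ :\ v => hM3 sv3.
case: (hM3) => -[hN hadj hact hin] hX3 hT.
have hv3 : rg M3 vV = v by rewrite sv3 //= sv2.
apply: run_seq; apply: run_put => //=; rewrite ?hv3 ?vw //=.
  by rewrite hact small_lt ?(leq_ltn_trans (leq_subr _ _)) ?small_lt; lia.
rewrite hact; set M4 := seta _ _ _ _; set S' := toggle S v in hQ.
have hS4 : stores S' W3 M4.
  split=> //= z; rewrite in_toggle; case: (eqVneq z v) => [->|zv].
    by rewrite eqxx; case: (v \in S).
  by rewrite hact; case: eqP => // /val_inj zv'; rewrite zv' eqxx in zv.
have {}hM4 : holds S' X W3 M4 by [].
apply: run_seq; apply: (run_find_pivot hS4) => X' hX'.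
apply: run_seq; apply: (@run_copy _ _ _ X') => //.
set M5 := setr _ _ _.
have hM5 : holds S' X W3 M5 by do 3!apply: holds_setr => //.
apply: run_seq; apply: (run_detach hM5) => //; first by rewrite !inE eqxx !andbF.
move=> M6 k6 lk6; set W6 := _ :\ X' => -[hS6 hX6 [T hT6]] sv6.
apply: run_seq; apply: (@run_copy _ _ _ X') => //; first by rewrite sv6.
have hM6 : holds S' X' W6 (setr M6 vX X').
  split=> //; exists T; rewrite -(contraction_change (X := X)) //.
    by rewrite !inE eqxx !andbF.
  by rewrite !inE eqxx.
have h6 : ord0 \notin W6 by rewrite !inE eqxx !andbF.
apply: run_seq; apply: (@run_copy _ _ _ X) => //; first by rewrite /= sv6 //= sv3 //= sv2.
have {}hM6 : holds S' X' W6 (setr (setr M6 vX X') vY X) by apply: holds_setr.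
(* Outside the old pivot, [v] and the new pivot nothing has changed; attaching those of the three
   that are now active restores all of [S'] but vertex 0. *)
pose att W y := if (y != ord0) && (y \in S') then y |: W else W.
have att0 W y : ord0 \notin W -> ord0 \notin att W y.
  rewrite /att; case: ifP => // /andP[y0 _] hW.
  by rewrite !inE negb_or eq_sym y0.
have attE W y z : (z \in att W y) = (z \in W) || [&& z == y, y != ord0 & y \in S'].
  rewrite /att; case: (y != ord0); case: (y \in S');
    by rewrite /= ?inE ?andbT ?andbF ?orbF // orbC.
apply: run_seq; apply: (run_attach hM6) => // M7 k7 lk7 hM7 sv7.
apply: run_seq; apply: (@run_copy _ _ _ v) => //.
  by rewrite sv7 //= sv6.
have {}hM7 := holds_setr (x := vY) v isT isT hM7.
apply: run_seq; apply: (run_attach hM7) => //; first exact: att0.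
move=> M8 k8 lk8 hM8 sv8.
apply: run_seq; apply: (@run_copy _ _ _ X') => //.
  by rewrite sv8 //= sv7 //= sv6.
have {}hM8 := holds_setr (x := vY) X' isT isT hM8.
apply: (run_attach hM8) => //; first by do 2!apply: (att0).
move=> M9 k9 lk9 hM9 sv9.
apply: hQ.
  move: lk2 lk3 lk6 lk7 lk8 lk9; clear; lia.
have {}hM9 : holds S' X' (att (att (att W6 X) v) X') M9 by [].
exists X' => //; congr (holds _ _ _ _): hM9; apply/setP=> z.
have eqE y : [&& z == y, y != ord0 & y \in S'] = (z == y) && ((z != ord0) && (z \in S')).
  by case: eqVneq => // ->.
rewrite !attE !eqE !inE in_toggle.
by case: (z == X); case: (z == X'); case: (z == v); case: (z == ord0); case: (z \in S).
Qed.

Lemma run_answer_query (cq : cmd) (bq : nat) S M (Q : nat -> mem -> Prop) :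
  (forall H T s, rep H T s -> dfs_tree H ord0 T) ->
  (forall H T s, rep H T s -> call w cq [::] s bq
     (fun s' => reg s' 0 = root_children H ord0 T /\ rep H T s')) ->
  represents S M ->
  (forall M' k, k <= bq + 30 -> rg M' 0 = connected (induced G S) ->
     represents S M' -> Q k M') ->
  run w (answer_query cq) M Q.
Proof.
move=> hdfs hcall [X hX hM] hQ; have [[hN hadj hact hin] rX [T hT]] := hM.
apply: run_ife => [//|||]; rewrite /= hN //; first exact: order_lt.
move=> _; apply: run_seq; apply: run_open_call.
apply: run_seq; apply: (run_shift _ (hcall _ _ _ hT)) => //= a' [hreg ha'].
set rc := root_children _ _ _ in hreg.
have rc_le : rc <= n.+1 by rewrite -[X in _ <= X](card_ord n.+1) max_card.
have rcw : rc + 1 < 2 ^ w by apply: small_lt; move: rc_le; clear; lia.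
apply: run_seq; apply: run_get_length => //=.
  by rewrite hreg; apply: leq_ltn_trans rcw; rewrite leq_addr.
have flagE : ar M aAct 0 * (rg M vX == 0) = (ord0 \in S) && (X == ord0).
  by rewrite rX (hact ord0) mulnb.
have valE : reg a' 0 + ar M aAct 0 * (rg M vX == 0) < 2 = connected (induced G S).
  by rewrite flagE hreg -(connected_children wfG vertsG hX (hdfs _ _ _ hT)).
apply: run_asg => //=.
- have rcw' : rc < 2 ^ w by apply: leq_ltn_trans rcw; rewrite leq_addr.
  have rcf : rc + ((ord0 \in S) && (X == ord0)) < 2 ^ w.
    by apply: leq_ltn_trans rcw; rewrite leq_add2l leq_b1.
  rewrite valE flagE hreg rX !bool_lt ord_lt rcw' rcf.
  by rewrite (@tiny_lt 0) // (@tiny_lt 2).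
- by rewrite valE bool_lt.
apply: hQ; [by clear; lia | by rewrite /= valE | exists X => //].
by split=> //; exists T.
Qed.

End Updates.

(** * Preprocessing *)

Definition set_array M a (f : nat -> nat) : mem :=
  Mem (rg M) (fun b => if b == a then f else ar M b) (sub M).

Definition input_at (act : seq 'I_n.+1) (es : seq ('I_n.+1 * 'I_n.+1)) M : Prop :=
  [/\ [/\ rg M vN = n.+1, rg M vM = size es & rg M vK = size act],
      forall k v, onth act k = Some v -> ar M 0 (3 + k) = v &
      forall k e, onth es k = Some e ->
        ar M 0 (3 + size act + 2 * k) = e.1 /\
        ar M 0 (3 + size act + (2 * k + 1)) = e.2].

Lemma size_active (act : seq 'I_n.+1) S : lists act S -> size act <= n.+1.
Proof.
by case=> /card_uniqP <- _; rewrite -[X in _ <= X](card_ord n.+1) max_card.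
Qed.

Lemma run_load_active act es S M (Q : nat -> mem -> Prop) :
  input_at act es M -> lists act S -> (forall i, ar M aAct i = 0) ->
  (forall f : nat -> nat, (forall i : 'I_n.+1, f i = (i \in S)) ->
     Q (6 + n.+1 * 20) (setr (set_array M aAct f) vI (size act))) ->
  run w load_active M Q.
Proof.
move=> [[hN hM hK] hact hes] hS h0 hQ; have szact := size_active hS.
pose f k z : nat := z \in map val (take k act).
pose F k := setr (set_array M aAct (f k)) vI k.
have actw : size act < 2 ^ w by apply: leq_ltn_trans szact order_lt.
suff : run w load_active M (fun b M' =>
    b <= 6 + n.+1 * 20 /\ M' = F (size act)).
  move/run_conseq; apply => b M' [hb ->]; exists (6 + n.+1 * 20), (F (size act)).
  split=> //; apply: hQ => i; rewrite /f take_size (mem_map val_inj).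
  by case: hS => _ ->.
apply: (@run_for _ _ _ _ 12 F (size act)) => //.
- by apply: small_lt; apply: leq_trans (_ : n.+2 <= _); rewrite ?ltnS //; lia.
- split=> // a i /=; case: eqP => // ->.
  by rewrite h0 /f take0.
- move=> k hk; move: (hk); rewrite -onthTE; case hv: (onth act k) => [v|] // _.
  have kw : 3 + k < 2 ^ w by apply: small_lt; have := leq_trans hk szact; clear; lia.
  have kw' : k < 2 ^ w by apply: leq_ltn_trans kw; rewrite leq_addl.
  apply: run_put => //=; rewrite ?kw ?kw' ?tiny_lt ?(hact k v hv) //.
  split=> //; split=> // a; first by rewrite /=; case: eqP.
  move=> i; rewrite /=; case: (a == aAct) => //.
  rewrite /f (take_nth v hk) (onth_nth v _ _ _ hv) map_rcons mem_rcons inE.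
  by case: eqP.
- by split=> //; rewrite leq_add2l leq_mul.
Qed.

(** Only the cells of actual edges are written, so the time is linear in their number; the zeros of
    the quadratic matrix come from the initial memory. *)
Lemma run_load_edges act es M (Q : nat -> mem -> Prop) :
  input_at act es M -> size act <= n.+1 -> lists_edges es (edges G) ->
  (forall i, ar M aAdj i = 0) ->
  (forall f : nat -> nat, (forall i j : 'I_n.+1, f (i * n.+1 + j) = adj G i j) ->
     Q (6 + size es * 58) (setr (set_array M aAdj f) vI (size es))) ->
  run w load_edges M Q.
Proof.
move=> [[hN hM hK] hact hes] szact hG h0 hQ; have szes := size_lists_edges hG.
pose cell (e : 'I_n.+1 * 'I_n.+1) z := (z == e.1 * n.+1 + e.2) || (z == e.2 * n.+1 + e.1).
pose f k z : nat := has (cell^~ z) (take k es).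
pose F k := setr (set_array M aAdj (f k)) vI k.
have cellE e (i j : 'I_n.+1) : cell e (i * n.+1 + j) = ([set i; j] == [set e.1; e.2]).
  (* Row and column are recovered from a matrix index as quotient and remainder. *)
  have inj (a a' b b' : 'I_n.+1) : (a * n.+1 + b == a' * n.+1 + b') = (a == a') && (b == b').
    apply/eqP/andP => [h|[/eqP-> /eqP->]] //; split; rewrite -val_eqE; apply/eqP => /=.
      by have := congr1 (divn^~ n.+1) h; rewrite /= !divnMDl // !divn_small // !addn0.
    by have := congr1 (modn^~ n.+1) h; rewrite /= !modnMDl !modn_small.
  rewrite /cell !inj; apply/orP/eqP => [[/andP[/eqP-> /eqP->]|/andP[/eqP-> /eqP->]]|] //.
    by rewrite setUC.
  by case/set2_eq => -[-> ->]; rewrite !eqxx; auto.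
suff : run w load_edges M (fun b M' => b <= 6 + size es * 58 /\ M' = F (size es)).
  move/run_conseq; apply => b M' [hb ->]; exists (6 + size es * 58), (F (size es)).
  split=> //; apply: hQ => i j; rewrite /f take_size; congr nat_of_bool.
  rewrite (eq_has (fun e => cellE e i j)) /adj; case: hG => _ <-.
  apply/hasP/mapP => [[e he /eqP h]|[e he h]]; exists e => //; exact/eqP.
apply: (@run_for _ _ _ _ 50 F (size es)) => //.
- by rewrite szes; apply: small_lt; lia.
- split=> // a i /=; case: eqP => // ->.
  by rewrite h0 /f take0.
- move=> k hk; move: (hk); rewrite -onthTE; case he: (onth es k) => [e|] // _.
  have [h1 h2] := hes k e he.
  have kw : 3 + size act + (2 * k + 1) < 2 ^ w.
    by apply: small_lt; move: szact hk; rewrite szes; clear; lia.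
  have lt_kw z : z <= 3 + size act + (2 * k + 1) -> z < 2 ^ w.
    by move=> hz; apply: leq_ltn_trans kw.
  have lt1 : 3 + size act < 2 ^ w by apply: lt_kw; clear; lia.
  have lt2 : 2 * k < 2 ^ w by apply: lt_kw; clear; lia.
  have lt3 : 2 * k + 1 < 2 ^ w by apply: lt_kw; clear; lia.
  have lt4 : 3 + size act + 2 * k < 2 ^ w by apply: lt_kw; clear; lia.
  have lt5 : size act < 2 ^ w by apply: lt_kw; clear; lia.
  have lt6 : k < 2 ^ w by apply: lt_kw; clear; lia.
  have lts := (lt1, lt2, lt3, lt4, lt5, lt6, kw, order_lt).
  apply: run_seq; apply: run_put => //=.
    by rewrite hN hK h1 h2 !lts row_lt entry_lt !tiny_lt.
    by rewrite tiny_lt.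
  apply: run_put => //=.
    by rewrite hN hK h1 h2 !lts row_lt entry_lt !tiny_lt.
    by rewrite tiny_lt.
  split=> //; split=> // a; first by rewrite /=; case: eqP.
  move=> i; rewrite /= hN hK h1 h2; case: (a == aAdj) => //.
  rewrite /f (take_nth e hk) (onth_nth e _ _ _ he) -cats1 has_cat /= orbF /cell orbC.
  by case: (i == _) (i == _) => [] [].
Qed.

Lemma run_load_contents S M (Q : nat -> mem -> Prop) :
  rg M vN = n.+1 -> (forall i : 'I_n.+1, ar M aAct i = (i \in S)) ->
  (forall i, ar M aIn i = 0) ->
  (forall f : nat -> nat, (forall i : 'I_n.+1, f i = (i \in S :\ ord0)) ->
     Q (6 + n.+1 * 28) (setr (set_array M aIn f) vI n.+1)) ->
  run w load_contents M Q.
Proof.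
move=> hN hact h0 hQ.
pose f k z : nat := [&& z < k, 0 < z & ar M aAct z != 0].
pose F k := setr (set_array M aIn (f k)) vI k.
suff : run w load_contents M (fun b M' => b <= 6 + n.+1 * 28 /\ M' = F n.+1).
  move/run_conseq; apply => b M' [hb ->]; exists (6 + n.+1 * 28), (F n.+1).
  split=> //; apply: hQ => i; rewrite /f ltn_ord lt0n !inE hact.
  by rewrite (_ : (val i != 0) = (i != ord0)) //; case: (i \in S).
apply: (@run_for _ _ _ _ 20 F n.+1) => //.
- by apply: small_lt; lia.
- split=> // a i /=; case: (eqVneq a aIn) => // ->.
  by rewrite h0 /f.
- move=> k hk; have actE := hact (Ordinal hk); rewrite /= in actE.
  have kw : k < 2 ^ w := ord_lt (Ordinal hk).
  apply: run_put => //=.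
    by rewrite actE mulnb kw !bool_lt tiny_lt.
  split=> //; split=> // a; first by rewrite /=; case: eqP.
  move=> i; rewrite /= actE; case: (a == aIn) => //=.
  rewrite /f ltnS (leq_eqVlt i); case: (eqVneq i k) => [->|] //=.
  by rewrite actE mulnb andbC; case: (_ \in S).
Qed.

Lemma run_load act es S M (Q : nat -> mem -> Prop) :
  input_at act es M -> lists act S -> lists_edges es (edges G) ->
  (forall a i, 0 < a < sub_arr -> ar M a i = 0) ->
  (forall M', input_at act es M' -> stores S (S :\ ord0) M' -> sub M' = sub M ->
     Q (20 + (#|edges G| + n.+1) * 60) M') ->
  run w load M Q.
Proof.
move=> hin hact hes h0 hQ; have szact := size_active hact.
have hb : 6 + n.+1 * 20 + (6 + size es * 58 + (6 + n.+1 * 28)) <=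
    20 + (#|edges G| + n.+1) * 60.
  by rewrite (size_lists_edges hes); clear; lia.
suff : run w load M (fun b M' => b <= 20 + (#|edges G| + n.+1) * 60 /\
    [/\ input_at act es M', stores S (S :\ ord0) M' & sub M' = sub M]).
  move/run_conseq; apply => b M' [hb' [h1 h2 h3]].
  exists (20 + (#|edges G| + n.+1) * 60), M'; split=> //.
  exact: hQ.
apply: run_seq; apply: (run_load_active hin hact) => [i|f hf]; first exact: h0.
case: hin => -[hN hM hK] hiact hies.
apply: run_seq; apply: (@run_load_edges act es) => // [i|g hg]; first exact: h0.
apply: (@run_load_contents S) => // i.
exact: h0.
Qed.

Section Initialization.

Variables (rep : graph n.+1 -> ('I_n.+1 -> 'I_n.+1) -> state -> Prop).
Variables (c : cmd) (b : nat).
Hypothesis preprocess_call : forall H vs es, rooted_graph (#|edges G| + n.+1) ord0 H ->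
  lists vs (verts H) -> lists_edges es (edges H) ->
  call w c (code_graph (#|edges G| + n.+1) ord0 vs es) zero_state b
    (fun s => exists T, rep H T s).

Lemma size_contraction_verts W : ord0 \notin W -> size (contraction_verts W) <= n.+1.
Proof. by move=> W0; apply: (size_active (lists_contraction_verts G ord0 W0)). Qed.

Lemma run_build act es S X W M (Q : nat -> mem -> Prop) :
  stores S W M -> rg M vX = X -> input_at act es M -> size act <= n.+1 ->
  lists_edges es (edges G) -> ord0 \notin W -> (X != ord0 -> X \in W) ->
  sub M = zero_state ->
  (forall M', holds rep S X W M' -> Q (b + 100 + (#|edges G| + n.+1) * 200) M') ->
  run w (build c) M Q.
Proof.
move=> hst hX hinp szact hes W0 hXW hsub hQ.
suff : run w (build c) M (fun k M' =>
    k <= b + 100 + (#|edges G| + n.+1) * 200 /\ holds rep S X W M').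
  move/run_conseq; apply => k M' [hk hM'].
  by exists (b + 100 + (#|edges G| + n.+1) * 200), M'; split=> //; apply: hQ.
have [hN hadj hact hin] := hst; have [[_ hM hK] _ hiedge] := hinp.
set m := #|edges G|.
have szes : size es = m := size_lists_edges hes.
set vs := contraction_verts W; set es' := contraction_edges G es X W.
(* The six words pushed at the start comprise the five header words and the root, the first entry of
   [vs]. *)
have vs6 : 6 + (size vs).-1 = size vs + 5 by rewrite addnC /= addSnnS.
have szvs : size vs <= n.+1 := size_contraction_verts W0.
have hes' := lists_contraction_edges wfG W0 hXW hes; rewrite -/es' in hes'.
have szes' : size es' <= m + n.+1.
  by rewrite (size_lists_edges hes'); case: (contraction_rooted G X W0).
have bound k : k <= 5 + size vs + 2 * size es' -> k < 2 ^ w.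
  move=> hk; apply: small_lt; rewrite -/m; move: hk szvs szes'; clear; lia.
have mw : m < 2 ^ w by apply: small_lt; rewrite -/m; clear; lia.
have mnw : m + n.+1 < 2 ^ w by apply: small_lt; rewrite -/m; clear; lia.
pose f1 (i : 'I_n.+1) := if i \in W then [:: val i] else [::].
have f1E : flatten (map f1 (enum 'I_n.+1)) = behead (code_verts vs).
  by rewrite flatten_if.
pose g1 (e : 'I_n.+1 * 'I_n.+1) :=
  if (e.1 \in W) && (e.2 \in W) then [:: val e.1; val e.2] else [::].
pose g2 (i : 'I_n.+1) := if i \in W then [:: 0; val i] else [::].
pose g3 (i : 'I_n.+1) := if fresh_neighbour G X W i then [:: val X; val i] else [::].
have gE : flatten (map g1 es) ++ flatten (map g2 (enum 'I_n.+1)) ++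
    flatten (map g3 (enum 'I_n.+1)) = code_edges es'.
  rewrite /g1 /g2 /g3 !flatten_if_seq /es' /contraction_edges /code_edges !map_cat !flatten_cat.
  by rewrite -!map_comp.
set G1 := flatten _ in gE; set G2 := flatten (map g2 _) in gE.
set G3 := flatten (map g3 _) in gE.
have szG : size G1 + (size G2 + size G3) = 2 * size es'.
  by rewrite -size_code_edges -gE !size_cat.
apply: run_seq; apply: run_open_call.
apply: run_seq; apply: (@run_pushes _ _ [::] zero_state) => //=.
- by rewrite hN hM szes order_lt mw mnw tiny_lt.
- by rewrite hsub.
- by rewrite tiny_lt.
rewrite hN hM szes.
apply: run_seq; apply: (@run_emit _ (enum 'I_n.+1) f1 _ _ _ _ _
  [:: n.+1; m + n.+1; 0; 0; 0; 0] zero_state) => //.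
- by rewrite size_enum_ord /= hN.
- by rewrite size_enum_ord; apply: small_lt; clear; lia.
- rewrite f1E size_cat size_behead size_map; apply: bound.
  by rewrite [X in X <= _]vs6; clear; lia.
- move=> k i /onth_enum_ord->; rewrite /= ord_lt hin.
  by split=> //; rewrite /f1; case: (i \in W).
rewrite f1E size_enum_ord.
set xs1 := _ ++ _.
have sz1 : size xs1 = size vs + 5 by rewrite size_cat size_behead size_map -vs6.
have w1 : size xs1 < 2 ^ w by rewrite sz1; apply: bound; clear; lia.
apply: run_seq; apply: run_get_length => //.
have fit : [&& size xs1 < 2 ^ w, 5 < 2 ^ w & size xs1 - 5 < 2 ^ w].
  by rewrite w1 tiny_lt // (leq_ltn_trans (leq_subr _ _) w1).
apply: run_seq; apply: (@run_poke _ _ _ xs1 zero_state) => //.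
- exact: tiny_lt.
rewrite (_ : eval _ _ = size vs); last by rewrite -(addnK 5 (size vs)) -sz1.
set xs2 := [:: n.+1; m + n.+1; 0; size vs; 0] ++ code_verts vs.
have sz2 : size xs2 = 5 + size vs by rewrite size_cat size_map.
rewrite (_ : set_nth _ _ _ _ = xs2) //.
have ow : (size (enum 'I_n.+1)).+1 < 2 ^ w.
  by rewrite size_enum_ord; apply: small_lt; clear; lia.
apply: run_seq; apply: (@run_emit _ es g1 _ _ _ _ _ xs2 zero_state) => //.
- by rewrite szes; apply: small_lt; rewrite -/m; clear; lia.
- by rewrite size_cat -/G1 sz2; apply: bound; rewrite -szG; clear; lia.
- move=> k e he; have [h1 h2] := hiedge k e he.
  have hk : k < m by rewrite -szes -onthTE he.
  have kw : 3 + size act + (2 * k + 1) < 2 ^ w.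
    by apply: small_lt; rewrite -/m; move: szact hk; clear; lia.
  have lt_kw z : z <= 3 + size act + (2 * k + 1) -> z < 2 ^ w.
    by move=> hz; apply: leq_ltn_trans kw.
  have lt1 : 3 + size act < 2 ^ w by apply: lt_kw; clear; lia.
  have lt2 : 2 * k < 2 ^ w by apply: lt_kw; clear; lia.
  have lt3 : 2 * k + 1 < 2 ^ w by apply: lt_kw; clear; lia.
  have lt4 : 3 + size act + 2 * k < 2 ^ w by apply: lt_kw; clear; lia.
  have lt5 : size act < 2 ^ w by apply: lt_kw; clear; lia.
  have lt6 : k < 2 ^ w by apply: lt_kw; clear; lia.
  have lts := (lt1, lt2, lt3, lt4, lt5, lt6, kw).
  rewrite /= hK h1 h2 !lts !hin mulnb bool_lt !tiny_lt //.
  by split=> //; rewrite /g1; case: (_ && _).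
rewrite -/G1 szes; set xs3 := xs2 ++ G1.
have sz3 : size xs3 = 5 + size vs + size G1 by rewrite size_cat sz2.
apply: run_seq; apply: (@run_emit _ (enum 'I_n.+1) g2 _ _ _ _ _ xs3 zero_state) => //.
- by rewrite size_enum_ord /= hN.
- by rewrite size_cat -/G2 sz3; apply: bound; rewrite -szG; clear; lia.
- move=> k i /onth_enum_ord->; rewrite /= ord_lt hin tiny_lt //.
  by split=> //; rewrite /g2; case: (i \in W).
rewrite -/G2 size_enum_ord; set xs4 := xs3 ++ G2.
have sz4 : size xs4 + size G3 = 5 + size vs + 2 * size es'.
  by rewrite size_cat sz3 -szG; clear; lia.
apply: run_seq; apply: (@run_emit _ (enum 'I_n.+1) g3 _ _ _ _ _ xs4 zero_state) => //.
- by rewrite size_enum_ord /= hN.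
- by rewrite size_cat -/G3 sz4; apply: bound; clear; lia.
- move=> k i /onth_enum_ord->; set M1 := setr _ _ _.
  have condE : eval M1 fresh_cond = fresh_neighbour G X W i.
    rewrite /M1 /= hN hX !hin hadj !(stores_row0 _ hst) !eqb0 !mulnb.
    by rewrite -andbA.
  rewrite condE /g3; split; last by case: fresh_neighbour; rewrite //= hX.
  + rewrite /M1 /= hN hX !hin hadj !(stores_row0 _ hst) !eqb0 !mulnb.
    by rewrite !bool_lt !ord_lt order_lt row_lt entry_lt tiny_lt.
  + by move=> _; rewrite /M1 /= hX !ord_lt.
rewrite -/G3 size_enum_ord; set xs5 := xs4 ++ G3.
have sz5 : size xs5 = 5 + size vs + 2 * size es' by rewrite size_cat sz4.
have w5 : size xs5 < 2 ^ w by rewrite sz5; apply: bound; clear; lia.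
apply: run_seq; apply: run_get_length => //.
have diffE : (size xs5 - size xs1) %/ 2 = size es'.
  by rewrite sz5 sz1 addnC (addnC 5) addnK mulKn.
have es'w : size es' < 2 ^ w by apply: bound; clear; lia.
have fit5 : [&& [&& size xs5 < 2 ^ w, size xs1 < 2 ^ w & size xs5 - size xs1 < 2 ^ w],
    2 < 2 ^ w & (size xs5 - size xs1) %/ 2 < 2 ^ w].
  by rewrite (leq_ltn_trans (leq_subr _ _) w5) diffE es'w w5 w1 tiny_lt.
apply: run_seq; apply: (@run_poke _ _ _ xs5 zero_state) => //.
- exact: tiny_lt.
rewrite (_ : eval _ _ = size es') //.
rewrite (_ : set_nth _ _ _ _ = code_graph (m + n.+1) ord0 vs es'); last first.
  by rewrite /code_graph -gE /xs5 /xs4 /xs3 -!catA.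
apply: (run_shift _ (preprocess_call _ _ hes')) => //.
- exact: contraction_rooted.
- exact: lists_contraction_verts.
move=> a' ha'; set M' := setsub _ a'.
split; last by [].
by rewrite /= -/m; clear; lia.
Qed.

Lemma run_initialize act es S M (Q : nat -> mem -> Prop) :
  lists act S -> lists_edges es (edges G) ->
  [/\ ar M 0 0 = n.+1, ar M 0 1 = #|edges G| & ar M 0 2 = size act] ->
  (forall k v, onth act k = Some v -> ar M 0 (3 + k) = v) ->
  (forall k e, onth es k = Some e ->
     ar M 0 (3 + size act + 2 * k) = e.1 /\
     ar M 0 (3 + size act + (2 * k + 1)) = e.2) ->
  (forall a i, 0 < a < sub_arr -> ar M a i = 0) -> sub M = zero_state ->
  (forall k M', k <= b + 200 + (#|edges G| + n.+1) * 300 ->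
     represents rep S M' -> Q k M') ->
  run w (initialize c) M Q.
Proof.
move=> hact hes [a0 a1 a2] hiact hies h0 hsub hQ.
have szact := size_active hact.
have mw : #|edges G| < 2 ^ w by apply: small_lt; clear; lia.
have kw : size act < 2 ^ w by apply: leq_ltn_trans szact order_lt.
apply: run_seq; apply: run_asg => //=; rewrite ?a0 ?order_lt ?tiny_lt //.
apply: run_seq; apply: run_asg => //=; rewrite ?a1 ?mw ?tiny_lt //.
apply: run_seq; apply: run_asg => //=; rewrite ?a2 ?kw ?tiny_lt //.
apply: run_ife => //=; first exact: order_lt.
move=> _; apply: run_seq; apply: (@run_load act es S) => //.
  by split=> //; rewrite /= (size_lists_edges hes).
move=> M' hin hst hsub'.
apply: run_seq; apply: (run_find_pivot hst) => X hX.
apply: run_seq; apply: (@run_copy _ _ _ X) => //.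
have hW0 : ord0 \notin S :\ ord0 by rewrite !inE eqxx.
have hXW : X != ord0 -> X \in S :\ ord0.
  by move=> X0; move: hX; rewrite /pivot (negbTE X0) !inE X0 => /and3P[].
apply: (@run_build act es S X (S :\ ord0)) => //=; first by rewrite hsub'.
move=> M2 hM2; apply: hQ; last by exists X.
by move: #|edges G| => m; clear; lia.
Qed.

End Initialization.

End Simulation.

(** * Calls of the reduction, the empty graph and the final bounds *)

Definition feed_mem (xs : seq nat) (M : mem) : mem :=
  Mem (fun x => if x == 0 then size xs else rg M x)
    (fun a i => if (a == 0) && (i < size xs) then nth 0 xs i else ar M a i)
    (sub M).

(** Register 0 and array 0 belong to the reduction, so receiving an input leaves the simulated
    memory intact. *)
Lemma models_feed xs s M : models s M -> models (feed xs s) (feed_mem xs M).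
Proof.
case=> h1 h2 h3 h4; split=> //= [x hx|a i ha]; first by rewrite h1.
by rewrite h2.
Qed.

Lemma ar_feed_mem xs M i : i < size xs -> ar (feed_mem xs M) 0 i = nth 0 xs i.
Proof. by rewrite /= => ->. Qed.

Lemma call_run w c xs s b M (P : state -> Prop) :
  models s M ->
  run w c (feed_mem xs M) (fun k M' =>
    size xs + k <= b /\ forall s', models s' M' -> P s') ->
  call w c xs s b P.
Proof.
move=> hM /(_ _ (models_feed xs hM))[t [s' [ex [k [M' [htk hM' [hb hP]]]]]]].
by exists t, s'; split=> //; [apply: leq_trans hb; rewrite leq_add2l | apply: hP].
Qed.

(** The source of both lower bounds: applied to the large witnesses, it bounds n and m by the
    running times of the simulated algorithm. *)
Lemma call_size w c xs s b P : call w c xs s b P -> size xs <= b.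
Proof. by case=> t [s' [_ h _]]; apply: leq_trans h; apply: leq_addr. Qed.

Definition zero_mem : mem := Mem (fun _ => 0) (fun _ _ => 0) zero_state.

Lemma models_zero : models zero_state zero_mem.
Proof. by []. Qed.

Lemma nth_code_edges n (es : seq ('I_n * 'I_n)) k e : onth es k = Some e ->
  [/\ 2 * k + 1 < size (code_edges es), nth 0 (code_edges es) (2 * k) = e.1
    & nth 0 (code_edges es) (2 * k + 1) = e.2].
Proof.
elim: es k => [|a es IH] [|k] //; first by case=> ->.
have -> : code_edges (a :: es) = [:: val a.1, val a.2 & code_edges es] by [].
by case/IH=> h1 h2 h3; rewrite mulnS !addSn add0n /= !ltnS h1.
Qed.

Lemma code_active_graph_nth n m (act : seq 'I_n) (es : seq ('I_n * 'I_n)) :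
  let xs := code_active_graph m act es in
  [/\ forall k v, onth act k = Some v -> 3 + k < size xs /\ nth 0 xs (3 + k) = v &
      forall k e, onth es k = Some e ->
        [/\ 3 + size act + (2 * k + 1) < size xs,
            nth 0 xs (3 + size act + 2 * k) = e.1 &
            nth 0 xs (3 + size act + (2 * k + 1)) = e.2]].
Proof.
split=> [k v hv|k e /nth_code_edges[h1 h2 h3]].
  have hk : k < size act by rewrite -onthTE hv.
  rewrite /code_active_graph /= size_cat size_map nth_cat size_map hk.
  rewrite !addSn !add0n; split; first by rewrite !ltnS ltn_addr.
  by rewrite (nth_map v) // (onth_nth v _ _ _ hv).
have nthE j : nth 0 (code_active_graph m act es) (3 + size act + j) =
    nth 0 (code_edges es) j.
  rewrite -addnA !addSn add0n /= nth_cat size_map ltnNge leq_addr /=.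
  by rewrite addKn.
rewrite !nthE; split=> //.
by rewrite /= size_cat size_map -addnA !addSn add0n !ltnS ltn_add2l.
Qed.

(** Without vertices the assumption on [A] cannot be instantiated with a root. Every operation then
    takes constant time, covered by [C] since bounds are read as at least 1. *)
Lemma solves_empty (A : dyn_algorithm) C p u q m w (G : graph 0) :
  C >= 30 -> 2 < 2 ^ w -> wf_graph G -> #|edges G| = m ->
  exists rep : {set 'I_0} -> state -> Prop,
  [/\ forall S act es, lists act S -> lists_edges es (edges G) ->
        call w (initialize (preprocess A)) (code_active_graph m act es) zero_state
          (C * p.+1) (rep S),
      forall S s v, rep S s ->
        call w (toggle_vertex (update A)) [:: val v] s (C * u.+1) (rep (toggle S v)) &
      forall S s, rep S s ->
        call w (answer_query (query A)) [::] s (C * q.+1)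
          (fun s' => reg s' 0 = connected (induced G S) /\ rep S s')].
Proof.
move=> hC hw wfG hm.
have m0 : m = 0.
  rewrite -hm; apply/eqP; rewrite cards_eq0; apply/eqP/setP => e; rewrite inE.
  apply/negP => /wfG[he _]; suff : #|e| <= 0 by rewrite he.
  by rewrite -[X in _ <= X](card_ord 0) max_card.
have w0 : 0 < 2 ^ w by lia.
have w1 : 1 < 2 ^ w by lia.
have ws := (hw, w0, w1).
exists (fun _ s => exists2 M, models s M & rg M vN = 0); split.
- move=> S [|[]//] [|[[]]//] _ _; rewrite m0.
  apply: (call_run models_zero).
  apply: run_seq; apply: run_asg => //=; rewrite ?ws //.
  apply: run_seq; apply: run_asg => //=; rewrite ?ws //.
  apply: run_seq; apply: run_asg => //=; rewrite ?ws //.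
  apply: run_ife => //= _; apply: run_skip; split.
    by move: hC; clear; nia.
  by move=> s' hs'; eexists; first exact: hs'.
- by move=> S s [].
- move=> S s [M hM hN]; apply: (call_run hM).
  apply: run_ife => //=; rewrite ?hN ?ws // => _.
  apply: run_asg => //=; rewrite ?ws //; split.
    by move: hC; clear; nia.
  move=> s' hs'; split; last by eexists; first exact: hs'.
  case: (hs') => -> // _ _ _ /=.
  by rewrite (_ : connected _ = true) //; apply/forall_inP => -[].
Qed.

Theorem theorem10 (p u q : nat -> nat -> nat) :
  (exists A : dyn_algorithm, maintains_dfs_tree A p u q) ->
  exists B : dyn_algorithm,
    solves_subgraph_connectedness B
      (fun m n => p (m + n) n)
      (fun m n => u (m + n) n)
      (fun m n => q (m + n) n).
Proof.
case=> A [C [k hA]].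
exists (DynAlgorithm (initialize (preprocess A)) (toggle_vertex (update A))
  (answer_query (query A))).
(* With [D] the base of the word bound, the simulated instance has base at most the square of [D],
   whence [2 * k]; the further factor of [D] to the power 4 leaves room for matrix indices. The
   factor 1000 absorbs the linear overheads once they are bounded by [C] times the simulated
   times. *)
exists (1000 * C.+1), (2 * k + 4) => m [|n] w G wfG vertsG hm hw.
  apply: solves_empty => //; first by clear; lia.
  apply: leq_trans hw; apply: (@leq_trans (2 ^ (2 * k + 4))).
    by rewrite expnD; apply: (@leq_trans (2 ^ 4)); rewrite // leq_pmull ?expn_gt0.
  by rewrite leq_exp2r ?addn4 // addn2.
set D := m + n.+1 + 2 in hw.
have wA : (m + n.+1 + n.+1 + 2) ^ k <= 2 ^ w.
  apply: leq_trans hw; rewrite expnD expnM.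
  apply: leq_trans (leq_pmulr _ _); last by rewrite expn_gt0 /D addn2.
  case: k {hA} => // k; rewrite leq_exp2r // /D -mulnn; clear; nia.
have word_size : n.+1 * n.+1 + 8 * (#|edges G| + n.+3) < 2 ^ w.
  apply: leq_trans hw; rewrite expnD.
  apply: (@leq_trans (D ^ 4)); last by rewrite leq_pmull // expn_gt0 /D addn2.
  rewrite hm (_ : m + n.+3 = D); last by rewrite /D; clear; lia.
  have nD : n.+1 <= D by rewrite /D; clear; lia.
  have D3 : 3 <= D by rewrite /D; clear; lia.
  have -> : D ^ 4 = (D * D) * (D * D) by rewrite !expnS expn0 muln1 !mulnA.
  have D9 : 9 * (D * D) <= (D * D) * (D * D) by rewrite leq_mul2r (leq_mul D3 D3) orbT.
  move: nD D3 D9; clear; nia.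
have [rep [hdfs hpre hupd hqry]] := hA (m + n.+1) n.+1 w ord0 wA.
set P := p _ _ in hpre *; set U := u _ _ in hupd *; set R := q _ _ in hqry *.
rewrite -hm in hpre hupd.
have large : n.+1 + 2 * m <= C * P.+1.
  have [H [vs [es [h1 h2 h3 h4]]]] := exists_large_graph wfG.
  rewrite -hm; apply: leq_trans (h4 (#|edges G| + n.+1)) _.
  exact: call_size (hpre H vs es h1 h2 h3).
have large_update : n.+1 <= 2 * (C * U.+1) + 1.
  case: (posnP n) => [->|n0]; first by rewrite addn1.
  have [H [v [N [h1 h2 h3 h4]]]] := exists_large_insertion n0 (leq_addl m n.+1).
  rewrite -hm in h1 h3.
  have wfH : wf_graph H by case: h1.
  have [es hes] := exists_lists_edges wfH.
  (* The update bound speaks only of memories that represent a graph; preprocessing [H] provides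
     one. *)
  have [|t [s [_ _ [T hT]]]] := hpre H (enum (verts H)) es h1 _ hes.
    by split=> [|x]; rewrite ?enum_uniq ?mem_enum.
  have := call_size (hupd H T s _ hT h2 h3).
  rewrite /= size_map h4; clear; lia.
exists (fun S s => exists2 M, models s M & represents G rep S M); split.
- move=> S act es hact hes; rewrite -hm.
  have [hv he] := code_active_graph_nth #|edges G| act es.
  apply: (call_run models_zero).
  apply: (run_initialize wfG word_size hpre hact hes) => //.
  + by move=> i v /hv[h1 h2]; rewrite ar_feed_mem.
  + move=> i e /he[h1 h2 h3]; rewrite !ar_feed_mem //.
    by apply: leq_ltn_trans h1; rewrite leq_add2l leq_addr.
  + by move=> [|a] i.
  move=> t M' ht hM'; split; last by move=> s' hs'; exists M'.
  have szact := size_active hact.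
  rewrite /code_active_graph /= size_cat size_map size_code_edges (size_lists_edges hes).
  move: large ht szact; rewrite hm; move: (size act) => K; clear; nia.
- move=> S s v [M hM hS]; apply: (call_run hM).
  apply: (run_toggle_vertex wfG word_size hupd) => //; first exact: hS.
  move=> M' t ht hM'; split; last by move=> s' hs'; exists M'.
  by move: large_update ht; rewrite /=; clear; nia.
- move=> S s [M hM hS]; apply: (call_run hM).
  apply: (run_answer_query wfG vertsG word_size hdfs hqry) => //; first exact: hS.
  move=> M' t ht hr hM'; split; last first.
    move=> s' hs'; split; last by exists M'.
    by case: hs' => -> //.
  by move: ht; rewrite /=; clear; nia.
Qed.
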